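(* Let $\Omega \subset \mathbf{C}^n$ be a domain and let $S \subset \Omega$ be a complex submanifold. (i) The ideal sheaf $\mathscr{I}\langle S\rangle$ is locally finite. (ii) Let $\sigma_1,\ldots,\sigma_N \in \mathcal{O}(\Omega)$ be finitely many holomorphic functions whose induced sections $\underline{\sigma_j}$ belong to $\Gamma(\Omega, \mathscr{I}\langle S\rangle)$ and form a finite generator system of $\mathscr{I}\langle S\rangle$ on $\Omega$, i.e., $\mathscr{I}\langle S\rangle=\sum_{j=1}^N \mathcal{O}\cdot\underline{\sigma_j}$. Then the relation sheaf $\mathscr{R}(\underline{\sigma_1},\ldots,\underline{\sigma_N})$ is locally finite.
   Context: $\mathcal{O}=\mathcal{O}_\Omega$ is the sheaf of germs of holomorphic functions on $\Omega$, with stalk $\mathcal{O}_z$ at $z$. For $f\in\mathcal{O}(\Omega)$, $\underline{f}\in\Gamma(\Omega,\mathcal{O})$ denotes the induced section and $\underline{f}_z\in\mathcal{O}_z$ its germ at $z$. A complex submanifold $S\subset\Omega$ is a closed complex submanifold (a non-singular analytic subset), not necessarily connected. The (non-singular) geometric ideal sheaf $\mathscr{I}\langle S\rangle\subset\mathcal{O}$ is the sheaf of germs of holomorphic functions vanishing on $S$; thus $\mathscr{I}\langle S\rangle_z=\mathcal{O}_z$ for $z\notin S$. An analytic sheaf on $\Omega$ is a sheaf of $\mathcal{O}$-modules. An analytic sheaf $\mathscr{F}$ is locally finite if every point of $\Omega$ has a neighborhood $U$ and finitely many sections of $\mathscr{F}$ over $U$ whose germs generate the $\mathcal{O}_z$-module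 $\mathscr{F}_z$ for every $z\in U$. The equality $\mathscr{I}\langle S\rangle=\sum_j\mathcal{O}\cdot\underline{\sigma_j}$ means that the germs $\underline{\sigma_j}_z$ generate $\mathscr{I}\langle S\rangle_z$ for every $z\in\Omega$. For sections $\xi_1,\ldots,\xi_q\in\Gamma(\Omega,\mathscr{F})$, the relation sheaf $\mathscr{R}(\xi_1,\ldots,\xi_q)$ is the subsheaf of $\mathcal{O}^q$ consisting of those germ-vectors $(\underline{f_1}_z,\ldots,\underline{f_q}_z)\in\mathcal{O}_z^q$, $z\in\Omega$, with $\underline{f_1}_z\xi_1(z)+\cdots+\underline{f_q}_z\xi_q(z)=0$. *)

(* Defs.v *)
From HB Require Import structures.
From mathcomp Require Import all_boot all_order all_algebra.
From mathcomp Require Import ring_quotient.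
From mathcomp Require Import all_classical all_reals all_analysis.
From mathcomp Require Import complex.

Set Implicit Arguments.
Unset Strict Implicit.
Unset Printing Implicit Defensive.

Import Order.TTheory GRing.Theory Num.Theory.
Import numFieldNormedType.Exports.
Local Open Scope classical_set_scope.
Local Open Scope ring_scope.
Local Open Scope complex_scope.

(* The topology and the normed C-module structure of C = R[i] given by the
   modulus: the library provides them on the alias R[i]^o only. *)
HB.instance Definition _ (R : realType) := NormedModule.copy R[i] R[i]^o.

Section Holomorphic.
Context {R : realType} {n : nat}.
Local Notation C := R[i].
Local Notation Cn := 'rV[C]_n.

(* [differentiable] is Frechet differentiability over the base field of the
   normed modules, here C: this is complex differentiability. *)
Definition holomorphic_near {W : normedModType C} (z : Cn) (f : Cn -> W) :=
  \forall w \near z, differentiable f w.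

Definition holomorphic_on {W : normedModType C} (U : set Cn) (f : Cn -> W) :=
  forall z, U z -> holomorphic_near z f.

(* [holomorphic_on] is meant for open sets, where it is complex
   differentiability at every point. *)
Lemma holomorphic_on_open {W : normedModType C} (U : set Cn) (f : Cn -> W) :
  open U -> holomorphic_on U f <-> forall z, U z -> differentiable f z.
Proof.
move=> oU; split=> [hf z /hf /nbhs_singleton //|hf z Uz].
by apply: filterS (open_nbhs_nbhs (conj oU Uz)) => w /hf.
Qed.

Definition domain (Omega : set Cn) :=
  [/\ open Omega, connected Omega & Omega !=set0].

Definition biholomorphic (U V : set Cn) (phi psi : Cn -> Cn) :=
  [/\ open U, open V, holomorphic_on U phi & holomorphic_on V psi] /\
  (forall z, U z -> V (phi z) /\ psi (phi z) = z) /\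
  (forall w, V w -> U (psi w) /\ phi (psi w) = w).

(* A closed complex submanifold of Omega: near each of its points it is given
   by the vanishing of the first q of some holomorphic local coordinates.
   The codimension q may depend on the point. *)
Definition complex_submanifold (Omega S : set Cn) :=
  [/\ S `<=` Omega,
      closure S `&` Omega `<=` S &
      forall a, S a ->
        exists (U V : set Cn) (phi psi : Cn -> Cn) (q : nat),
          [/\ U a, U `<=` Omega, biholomorphic U V phi psi, (q <= n)%N &
              S `&` U =
              [set z | U z /\ forall k : 'I_n, (k < q)%N -> phi z ord0 k = 0]]].

End Holomorphic.

Section Stalk.
Context {R : realType} {n : nat}.
Local Notation C := R[i].
Local Notation Cn := 'rV[C]_n.
Implicit Types z w : Cn.

Definition holo_pred z : {pred Cn -> C} := fun f => `[< holomorphic_near z f >].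

Lemma holo_predP z f : reflect (holomorphic_near z f) (f \in holo_pred z).
Proof. exact: asboolP. Qed.

Lemma holo_subring z : subring_closed (holo_pred z).
Proof.
split=> [|f g /holo_predP hf /holo_predP hg|f g /holo_predP hf /holo_predP hg];
  apply/holo_predP.
- by apply: filterE => w; exact: differentiable_cst.
- by apply: filterS2 hf hg => w df dg; exact: differentiableB.
- by apply: filterS2 hf hg => w df dg; exact: differentiableM.
Qed.

HB.instance Definition _ z :=
  GRing.isSubringClosed.Build (Cn -> C) (holo_pred z) (holo_subring z).

Record holo_fun z := HoloFun {
  holo_val :> Cn -> C;
  _ : holo_val \in holo_pred z }.

HB.instance Definition _ z := [isSub for @holo_val z].
HB.instance Definition _ z := [Choice of holo_fun z by <:].
HB.instance Definition _ z :=
  [SubChoice_isSubComNzRing of holo_fun z by <:].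

Definition null_pred (z : Cn) : {pred holo_fun z} :=
  fun f => `[< \forall w \near z, f w = 0 >].
Arguments null_pred z : clear implicits.

Lemma null_predP z (f : holo_fun z) :
  reflect (\forall w \near z, f w = 0) (f \in null_pred z).
Proof. exact: asboolP. Qed.

Lemma null_ideal z : idealr_closed (null_pred z).
Proof.
split=> [||h f g /null_predP hf /null_predP hg].
- by apply/null_predP; exact: filterE.
- apply/negP => /null_predP /nbhs_singleton /eqP.
  by rewrite [X in X == _ -> _]/(1 : C) oner_eq0.
- apply/null_predP; apply: filterS2 hf hg => w f0 g0.
  by transitivity (h w * f w + g w); rewrite // f0 g0 mulr0 addr0.
Qed.

HB.instance Definition _ z :=
  isIdealr.Build (holo_fun z) (null_pred z) (null_ideal z).

(* The ring O_z of germs at z of holomorphic functions: functions holomorphic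
   near z, modulo those that vanish near z. *)
Definition stalk z : Type := {ideal_quot (null_pred z)}.
HB.instance Definition _ z := GRing.ComNzRing.on (stalk z).

(* The germ of f at z; it is 0 by convention if f is not holomorphic near z. *)
Definition germ z (f : Cn -> C) : stalk z :=
  \pi_(stalk z)%qT (insubd (0 : holo_fun z) f).

Lemma germ_eq z (f g : Cn -> C) :
  holomorphic_near z f -> holomorphic_near z g ->
  germ z f = germ z g <-> \forall w \near z, f w = g w.
Proof.
move=> /holo_predP hf /holo_predP hg; rewrite /germ; split.
  move=> /eqP; rewrite -Quotient.idealrBE => /null_predP; apply: filterS => w /=.
  rewrite [X in X = 0]/(val (insubd (0 : holo_fun z) f) w
                        - val (insubd (0 : holo_fun z) g) w).
  by rewrite !insubdK // => /eqP; rewrite subr_eq0 => /eqP.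
move=> fg; apply/eqP; rewrite -Quotient.idealrBE; apply/null_predP.
apply: filterS fg => w fgw; transitivity (val (insubd (0 : holo_fun z) f) w
                        - val (insubd (0 : holo_fun z) g) w) => //.
by rewrite !insubdK // fgw subrr.
Qed.

Lemma germ_surj z (u : stalk z) : exists2 f, holomorphic_near z f & germ z f = u.
Proof.
exists (val (repr u)); first exact/holo_predP/valP.
by rewrite /germ valKd reprK.
Qed.

Lemma holo_nearD z (f g : Cn -> C) : holomorphic_near z f ->
  holomorphic_near z g -> holomorphic_near z (f \+ g).
Proof. by apply: filterS2 => w; exact: differentiableD. Qed.

Lemma holo_nearM z (f g : Cn -> C) : holomorphic_near z f ->
  holomorphic_near z g -> holomorphic_near z (f \* g).
Proof. by apply: filterS2 => w; exact: differentiableM. Qed.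

Lemma holo_near0 z : holomorphic_near z (fun=> 0 : C).
Proof. by apply: filterE => w; exact: differentiable_cst. Qed.

Lemma germ0 z : germ z (fun=> 0) = 0.
Proof.
rewrite -[RHS](raddf0 (\pi_(stalk z)%qT)) /germ; congr (\pi_(stalk z)%qT _).
by apply: val_inj; rewrite insubdK //; exact/holo_predP/holo_near0.
Qed.

Lemma germD z (f g : Cn -> C) : holomorphic_near z f -> holomorphic_near z g ->
  germ z (f \+ g) = germ z f + germ z g.
Proof.
move=> hf hg; rewrite /germ -raddfD; congr (\pi_(stalk z)%qT _).
apply: val_inj; rewrite insubdK; last exact/holo_predP/holo_nearD.
by rewrite raddfD /= !insubdK //; exact/holo_predP.
Qed.

Lemma germM z (f g : Cn -> C) : holomorphic_near z f -> holomorphic_near z g ->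
  germ z (f \* g) = germ z f * germ z g.
Proof.
move=> hf hg; rewrite /germ -rmorphM; congr (\pi_(stalk z)%qT _).
apply: val_inj; rewrite insubdK; last exact/holo_predP/holo_nearM.
by rewrite rmorphM /= !insubdK //; exact/holo_predP.
Qed.

Lemma germ_sumM z N (f g : 'I_N -> Cn -> C) :
  (forall j, holomorphic_near z (f j)) -> (forall j, holomorphic_near z (g j)) ->
  holomorphic_near z (fun w => \sum_j f j w * g j w) /\
  germ z (fun w => \sum_j f j w * g j w) = \sum_j germ z (f j) * germ z (g j).
Proof.
move=> hf hg.
have -> : (fun w => \sum_j f j w * g j w) = \sum_j (f j \* g j).
  by apply/funext => w; rewrite fct_sumE.
apply: (big_ind2 (fun a b => holomorphic_near z a /\ germ z a = b)).
- by split; [exact: holo_near0|exact: germ0].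
- move=> a u b v [ha <-] [hb <-].
  by split; [exact: holo_nearD|exact: germD].
- by move=> j _; split; [exact: holo_nearM|exact: germM].
Qed.

Definition germ_vec q z (f : 'I_q -> Cn -> C) : 'rV[stalk z]_q :=
  \row_k germ z (f k).

Lemma germ_vec_surj q z (v : 'rV[stalk z]_q) :
  exists2 f, (forall k, holomorphic_near z (f k)) & germ_vec z f = v.
Proof.
have /choice [f hf] : forall k, exists f, holomorphic_near z f /\ germ z f = v ord0 k.
  by move=> k; have [f] := germ_surj (v ord0 k); exists f.
exists f => [k|]; first by case: (hf k).
by apply/rowP => k; rewrite mxE; case: (hf k).
Qed.

End Stalk.

Section Sheaves.
Context {R : realType} {n : nat}.
Local Notation C := R[i].
Local Notation Cn := 'rV[C]_n.

(* An analytic subsheaf F of O^q on Omega, given by its stalks: each F_z is an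
   O_z-submodule of O_z^q, and the union of the F_z is open in the sheaf space
   O^q, i.e. a germ in F_z is represented by functions whose germs at all nearby
   points w are in F_w. Only the stalks at the points of Omega matter. *)
Unset Implicit Arguments.
Record analytic_subsheaf (Omega : set Cn) (q : nat) := AnalyticSubsheaf {
  sheaf_stalk : forall z : Cn, set 'rV[stalk z]_q;
  sheaf_stalk0 : forall z, Omega z -> sheaf_stalk z 0;
  sheaf_stalkD : forall z, Omega z -> forall u v,
    sheaf_stalk z u -> sheaf_stalk z v -> sheaf_stalk z (u + v);
  sheaf_stalkZ : forall z, Omega z -> forall (c : stalk z) u,
    sheaf_stalk z u -> sheaf_stalk z (c *: u);
  sheaf_open : forall z, Omega z -> forall u, sheaf_stalk z u ->
    exists f : 'I_q -> Cn -> C,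
      [/\ forall k, holomorphic_near z (f k), germ_vec z f = u &
          \forall w \near z, Omega w -> sheaf_stalk w (germ_vec w f)] }.
Set Implicit Arguments.
Arguments sheaf_stalk {Omega q} F z _ : rename.

Section Generation.
Context {Omega : set Cn} {q : nat}.
Implicit Types (F : analytic_subsheaf Omega q) (U : set Cn).

(* f belongs to Gamma(U, F); sections of O^q over an open set U are q-tuples of
   holomorphic functions on U. *)
Definition is_section F U (f : 'I_q -> Cn -> C) :=
  (forall k, holomorphic_on U (f k)) /\
  (forall z, U z -> sheaf_stalk F z (germ_vec z f)).

(* F = \sum_j O . xi_j on U *)
Definition generates F U m (xi : 'I_m -> 'I_q -> Cn -> C) :=
  forall z, U z -> sheaf_stalk F z =
    [set \sum_j c j *: germ_vec z (xi j) | c in [set: 'I_m -> stalk z]].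

Definition locally_finite F :=
  forall a, Omega a -> exists U : set Cn,
    [/\ open U, U a, U `<=` Omega &
        exists (m : nat) (xi : 'I_m -> 'I_q -> Cn -> C),
          (forall j, is_section F U (xi j)) /\ generates F U xi].

End Generation.

(* The germs at z of the holomorphic functions vanishing on S near z. *)
Definition ideal_stalk (S : set Cn) (z : Cn) : set (stalk z) :=
  [set u | exists f, [/\ holomorphic_near z f, germ z f = u &
                         \forall w \near z, S w -> f w = 0]].

Arguments ideal_stalk S z _ : clear implicits.

Section IdealSheaf.
Variables (Omega S : set Cn).

(* O is identified with O^1. *)
Definition ideal_stalk1 (z : Cn) : set 'rV[stalk z]_1 :=
  [set v | ideal_stalk S z (v ord0 ord0)].

Lemma ideal_stalk0 z : Omega z -> ideal_stalk1 (0 : 'rV[stalk z]_1).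
Proof.
move=> _; exists (fun=> 0); rewrite mxE; split; last exact: filterE.
  exact: holo_near0.
exact: germ0.
Qed.

Lemma ideal_stalkD z : Omega z -> forall u v : 'rV[stalk z]_1,
  ideal_stalk1 u -> ideal_stalk1 v -> ideal_stalk1 (u + v).
Proof.
move=> _ u v [f [hf fu f0]] [g [hg gv g0]]; exists (f \+ g); rewrite mxE.
split; [exact: holo_nearD|by rewrite germD // fu gv|].
by apply: filterS2 f0 g0 => w f0 g0 Sw; rewrite /= f0 // g0 // addr0.
Qed.

Lemma ideal_stalkZ z : Omega z -> forall (c : stalk z) (u : 'rV[stalk z]_1),
  ideal_stalk1 u -> ideal_stalk1 (c *: u).
Proof.
move=> _ c u [f [hf fu f0]]; have [h hh <-] := germ_surj c.
exists (h \* f); rewrite mxE; split; [exact: holo_nearM|by rewrite germM // fu|].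
by apply: filterS f0 => w f0 Sw; rewrite /= f0 // mulr0.
Qed.

Lemma ideal_stalk_open z : Omega z -> forall u : 'rV[stalk z]_1, ideal_stalk1 u ->
  exists f : 'I_1 -> Cn -> C,
    [/\ forall k, holomorphic_near z (f k), germ_vec z f = u &
        \forall w \near z, Omega w -> ideal_stalk1 (germ_vec w f)].
Proof.
move=> _ u [f [hf fu f0]]; exists (fun=> f); split=> [k||].
- exact: hf.
- by apply/rowP => k; rewrite mxE fu (ord1 k).
- have hf2 := near_join hf; have f02 := near_join f0.
  by apply: filterS2 hf2 f02 => w hw w0 _; exists f; rewrite mxE; split.
Qed.

Definition ideal_sheaf : analytic_subsheaf Omega 1 :=
  AnalyticSubsheaf Omega 1 ideal_stalk1 ideal_stalk0 ideal_stalkD ideal_stalkZ ideal_stalk_open.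

End IdealSheaf.

Section RelationSheaf.
Variables (Omega : set Cn) (p N : nat) (F : analytic_subsheaf Omega p).
Variables (xi : 'I_N -> 'I_p -> Cn -> C).
Hypothesis xiF : forall j, is_section F Omega (xi j).

Definition relation_stalk (z : Cn) : set 'rV[stalk z]_N :=
  [set v | \sum_j v ord0 j *: germ_vec z (xi j) = 0].

Lemma relation_stalk0 z : Omega z -> relation_stalk (0 : 'rV[stalk z]_N).
Proof. by move=> _; apply: big1 => j _; rewrite mxE scale0r. Qed.

Lemma relation_stalkD z : Omega z -> forall u v : 'rV[stalk z]_N,
  relation_stalk u -> relation_stalk v -> relation_stalk (u + v).
Proof.
move=> _ u v u0 v0; rewrite /relation_stalk /=.
under eq_bigr do rewrite mxE scalerDl.
by rewrite big_split /= u0 v0 addr0.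
Qed.

Lemma relation_stalkZ z : Omega z -> forall (c : stalk z) (u : 'rV[stalk z]_N),
  relation_stalk u -> relation_stalk (c *: u).
Proof.
move=> _ c u u0; rewrite /relation_stalk /=.
under eq_bigr do rewrite mxE -scalerA.
by rewrite -scaler_sumr u0 scaler0.
Qed.

Lemma relation_stalk_germ z (f : 'I_N -> Cn -> C) : Omega z ->
  (forall j, holomorphic_near z (f j)) ->
  relation_stalk (germ_vec z f) <->
  forall k, \forall w \near z, \sum_j f j w * xi j k w = 0.
Proof.
move=> Oz hf.
have hxi k j : holomorphic_near z (xi j k) by case: (xiF j) => h _; exact: h.
have gE k : (\sum_j germ_vec z f ord0 j *: germ_vec z (xi j)) ord0 k
    = germ z (fun w => \sum_j f j w * xi j k w).
  have [_ ->] := germ_sumM hf (hxi k).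
  by rewrite summxE; apply: eq_bigr => j _; rewrite !mxE.
have E k : germ z (fun w => \sum_j f j w * xi j k w) = 0 <->
    \forall w \near z, \sum_j f j w * xi j k w = 0.
  rewrite -germ0; apply: germ_eq; last exact: holo_near0.
  by have [] := germ_sumM hf (hxi k).
rewrite /relation_stalk /=; split=> [f0 k|f0].
  by apply/E; rewrite -gE f0 mxE.
by apply/rowP => k; rewrite gE mxE; apply/E.
Qed.

Lemma relation_stalk_open z : Omega z -> forall u : 'rV[stalk z]_N,
  relation_stalk u -> exists f : 'I_N -> Cn -> C,
    [/\ forall j, holomorphic_near z (f j), germ_vec z f = u &
        \forall w \near z, Omega w -> relation_stalk (germ_vec w f)].
Proof.
move=> Oz u; have [f hf <-] := germ_vec_surj u => /(relation_stalk_germ Oz hf) f0.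
exists f; split=> //.
have /filter_forall h1 : forall j, \forall w \near z, holomorphic_near w (f j).
  by move=> j; exact: near_join (hf j).
have /filter_forall h2 : forall k, \forall w \near z,
    \forall w' \near w, \sum_j f j w' * xi j k w' = 0.
  by move=> k; exact: near_join (f0 k).
by apply: filterS2 h1 h2 => w h1 h2 Ow; apply/relation_stalk_germ.
Qed.

Definition relation_sheaf : analytic_subsheaf Omega N :=
  AnalyticSubsheaf Omega N relation_stalk relation_stalk0 relation_stalkD relation_stalkZ
    relation_stalk_open.

End RelationSheaf.

End Sheaves.

(* Main.v *)
Require Import Defs.
From HB Require Import structures.
From mathcomp Require Import all_boot all_order all_algebra.
From mathcomp Require Import all_classical all_reals all_analysis.
From mathcomp Require Import complex.
From mathcomp Require Import ring lra.

(** Locally, everything follows from a division statement: if g is holomorphic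
    near b and b_k = 0, then g(w) - g(w with w_k replaced by 0) = w_k h(w) with h
    holomorphic near b ([Hadamard_division]). By induction on q it shows that the
    functions vanishing on the coordinate subspace w_1 = ... = w_q = 0 are the
    combinations of w_1, ..., w_q ([coord_ideal]), and that the relations among
    these coordinates are the combinations of the Koszul relations
    w_i e_j - w_j e_i ([coord_koszul]). Holomorphic charts carry both facts to S.
    At a point where one of the local equations is nonzero, that equation is a
    unit and both facts are immediate; thus finitely many functions phi near a
    given point generate the ideal of S, and their Koszul relations generate all
    relations, at every nearby point ([local_equations]). This proves (i).

    For (ii), the ideals generated by sigma and by phi coincide, so near a given
    point sigma = A phi and phi = B sigma for holomorphic matrices A and B. A
    relation f of sigma decomposes as f = f (1 - AB) + (f A) B; the rows of 1 - AB
    are relations of sigma, and f A is a relation of phi, hence a combination of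
    Koszul relations. So the rows of 1 - AB and the Koszul relations multiplied
    by B generate the relations of sigma at every nearby point.

    The division statement rests on the regularity of functions which are merely
    complex differentiable. Goursat's bisection gives the vanishing of boundary
    integrals over rectangles ([Goursat]). Through the exponential, this becomes
    the mean value property on circles, for functions that are continuous at the
    centre and differentiable elsewhere ([circle_mean_value]). Applied to
    difference quotients, it writes f'(z) as an average over a circle of
    differences of values of f ([deriv_formula]). A bound for f thus gives
    one for f', hence a Lipschitz constant for f, hence by the same formula one for
    f', and finally a quadratic bound for the error of the first-order expansion
    of f, which depends on f only through a bound for |f| ([quadratic_estimate]).
    Restricted to complex lines, this controls functions of several variables,
    and its uniformity shows that an integral of functions holomorphic in a
    parameter is holomorphic in it ([differentiable_cint]). Directional
    derivatives are such integrals ([differentiable_partial]), and so is the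
    quotient h, by the fundamental theorem of calculus. *)

Set Implicit Arguments.
Unset Strict Implicit.
Unset Printing Implicit Defensive.
Import Order.TTheory GRing.Theory Num.Theory.
Import numFieldNormedType.Exports.
Local Open Scope classical_set_scope.
Local Open Scope ring_scope.
Local Open Scope complex_scope.
Local Notation Re := complex.Re.
Local Notation Im := complex.Im.

(** * The norm as a real number *)

Section RealNorm.
Context {R : realType}.
Local Notation C := R[i].

(** The norm of a normed space over [R[i]] is a real element of [R[i]], where the
    order is partial; [nm] is its value in [R]. *)
Definition nm {V : normedModType C} (v : V) : R := Re `|v|.

Lemma nmE {V : normedModType C} (v : V) : `|v| = (nm v)%:C.
Proof. by rewrite /nm RRe_real // ger0_real. Qed.

Lemma nm_ge0 {V : normedModType C} (v : V) : 0 <= nm v.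
Proof. by rewrite -ler0c -nmE. Qed.

Lemma nmD {V : normedModType C} (u v : V) : nm (u + v) <= nm u + nm v.
Proof. by rewrite -lecR rmorphD /= -!nmE ler_normD. Qed.

Lemma nmN {V : normedModType C} (u : V) : nm (- u) = nm u.
Proof. by rewrite /nm normrN. Qed.

Lemma nmC {V : normedModType C} (u v : V) : nm (u - v) = nm (v - u).
Proof. by rewrite -nmN opprB. Qed.

Lemma nmB {V : normedModType C} (u v : V) : nm (u - v) <= nm u + nm v.
Proof. by rewrite -(nmN v) nmD. Qed.

Lemma nm0 {V : normedModType C} : nm (0 : V) = 0.
Proof. by rewrite /nm normr0. Qed.

Lemma nm_eq0 {V : normedModType C} (v : V) : nm v = 0 -> v = 0.
Proof. by move=> v0; apply/eqP; rewrite -normr_eq0 nmE v0. Qed.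

Lemma nm_gt0 {V : normedModType C} (v : V) : v != 0 -> 0 < nm v.
Proof. by rewrite -normr_gt0 nmE -ltcR. Qed.

Lemma nmZ {V : normedModType C} (c : C) (v : V) : nm (c *: v) = nm c * nm v.
Proof. by apply: complexI; rewrite rmorphM /= -!nmE normrZ. Qed.

Lemma nmM (x y : C) : nm (x * y) = nm x * nm y.
Proof. by apply: complexI; rewrite rmorphM /= -!nmE normrM. Qed.

Lemma nm1 : nm (1 : C) = 1.
Proof. by rewrite /nm normr1. Qed.

Lemma nmR (x : R) : nm (x%:C : C) = `|x|.
Proof. by rewrite /nm normc_def /= expr0n /= addr0 sqrtr_sqr. Qed.

Lemma nm_Re (x : C) : `|Re x| <= nm x.
Proof. by rewrite -lecR -nmE normc_ge_Re. Qed.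

Lemma nm_i : nm ('i%C : C) = 1.
Proof. by rewrite /nm normc_def /= expr0n /= expr1n add0r sqrtr1. Qed.

Lemma nm_Im (x : C) : `|Im x| <= nm x.
Proof. by rewrite -[Im x]opprK -ReiNIm normrN (le_trans (nm_Re _)) // nmM nm_i mulr1. Qed.

Lemma nm_ReIm (x : C) : nm x <= `|Re x| + `|Im x|.
Proof.
rewrite {1}[x]complexE (le_trans (nmD _ _)) // nmR nmM nm_i mul1r.
by rewrite lerD2l nmR.
Qed.

Lemma nmV (x : C) : nm (x^-1) = (nm x)^-1.
Proof. by apply: complexI; rewrite fmorphV /= -!nmE normfV. Qed.

Lemma nbhs_nmP {V : normedModType C} (p : V) (A : set V) :
  nbhs p A <-> exists2 d : R, 0 < d & forall v, nm (v - p) < d -> A v.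
Proof.
split=> [/nbhs_normP [e /= e0 eA]|[d d0 dA]].
  have eE : e = (Re e)%:C by rewrite RRe_real // gtr0_real.
  exists (Re e); first by rewrite -ltcR -eE.
  move=> v vd; apply: eA; rewrite /ball_ /= nmE nmC eE ltcR //.
apply/nbhs_normP; exists d%:C; first by rewrite /= ltcR.
by move=> v; rewrite /ball_ /= nmE ltcR nmC => /dA.
Qed.

End RealNorm.
(** * Differentiability by estimates *)

Section Differentiability.
Context {R : realType}.
Local Notation C := R[i].
Implicit Types V W : normedModType C.

Lemma differentiable_estimate V W (f : V -> W) p : differentiable f p ->
  forall e : R, 0 < e -> exists2 d : R, 0 < d & forall h, nm h < d ->
    nm (f (p + h) - f p - 'd f p h) <= e * nm h.
Proof.
move=> /diff_locallyP [_ /eqaddoP df] e e0.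
have /nbhs_nmP [d d0 dP] : \forall h \near (0 : V),
    `|(f \o shift p - (cst (f p) + 'd f p)) h| <= e%:C * `|h|.
  by apply: df; rewrite ltcR.
exists d => // h hd; have := dP h; rewrite subr0 => /(_ hd).
rewrite !nmE -rmorphM lecR; congr (_ <= _); congr nm.
by rewrite /= -addrA -opprD [p + h]addrC.
Qed.

(** The bound on [L] gives its continuity, the estimate makes it a differential
    of [f] at [p]; differentials are unique. *)
Lemma estimate_differentiable V W (f L : V -> W) p (K : R) : linear L ->
  (forall v, nm (L v) <= K * nm v) ->
  (forall e : R, 0 < e -> exists2 d : R, 0 < d & forall h, nm h < d ->
    nm (f (p + h) - f p - L h) <= e * nm h) ->
  differentiable f p /\ 'd f p = L :> (V -> W).
Proof.
move=> linL bL eL.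
pose Lm := GRing.isLinear.Build C V W _ L linL.
pose Ll : {linear V -> W} := HB.pack L Lm.
have cL : continuous Ll.
  move=> x A /nbhs_nmP [e e0 eA]; apply/nbhs_nmP.
  have K0 : 0 < `|K| + 1 by rewrite ltr_wpDl.
  exists (e / (`|K| + 1)); first by rewrite divr_gt0.
  move=> v; rewrite ltr_pdivlMr // => vx; apply: eA.
  rewrite -linearB; apply: le_lt_trans (bL _) (le_lt_trans _ vx).
  by rewrite mulrC ler_wpM2l ?nm_ge0 // (le_trans (ler_norm _)) ?lerDl.
have E : f \o shift p = cst (f p) + Ll +o_ 0 id.
  apply/eqaddoP => e e0; rewrite -nbhs_nearE.
  have eE : e = (Re e)%:C by rewrite RRe_real // gtr0_real.
  have [|d d0 dP] := eL (Re e); first by rewrite -ltcR -eE.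
  apply/nbhs_nmP; exists d => // h; rewrite subr0 => /dP.
  rewrite eE !nmE -rmorphM lecR; congr (_ <= _); congr nm.
  by rewrite -[RHS]/(f (h + p) - (f p + L h)) opprD addrA [p + h]addrC.
have dE := diff_unique cL E.
split; last by rewrite dE.
by apply/diff_locallyP; rewrite dE.
Qed.

End Differentiability.
(** * Integrals of complex functions of a real variable *)

Section ComplexIntegral.
Context {R : realType}.
Local Notation C := R[i].
Local Notation mu := (@lebesgue_measure R).
Implicit Types (f g : R -> C) (a b c : R).

(** Continuity on [[a, b]] by estimates between points of [[a, b]]: stable under
    the operations of [R[i]] and, through [nm], passed on to real and imaginary
    parts. *)
Definition ccont a b f := forall x, a <= x <= b -> forall e : R, 0 < e ->
  exists2 d : R, 0 < d & forall y, a <= y <= b -> `|y - x| < d ->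
    nm (f y - f x) <= e.

Definition cint a b f : C :=
  (\int[mu]_(x in `[a, b]) Re (f x)) +i* (\int[mu]_(x in `[a, b]) Im (f x)).

Lemma ccont_eq a b f g : (forall x, a <= x <= b -> f x = g x) ->
  ccont a b f -> ccont a b g.
Proof.
move=> fg cf x xab e e0; have [d d0 dP] := cf x xab e e0; exists d => // y yab.
by rewrite -!fg //; exact: dP.
Qed.

Lemma ccont_cst a b (c : C) : ccont a b (fun=> c).
Proof. by move=> x _ e e0; exists 1 => // y _ _; rewrite subrr nm0 ltW. Qed.

Lemma ccontD a b f g : ccont a b f -> ccont a b g ->
  ccont a b (fun x => f x + g x).
Proof.
move=> cf cg x xab e e0; have e20 : 0 < e / 2 by rewrite divr_gt0.
have [d d0 dP] := cf x xab _ e20; have [d' d'0 d'P] := cg x xab _ e20.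
exists (Num.min d d'); first by rewrite lt_min d0.
move=> y yab; rewrite lt_min => /andP[/dP-/(_ yab) A /d'P-/(_ yab) B].
have -> : f y + g y - (f x + g x) = (f y - f x) + (g y - g x) by ring.
by rewrite (le_trans (nmD _ _)) // [leRHS]splitr lerD.
Qed.

Lemma ccontM a b f g : ccont a b f -> ccont a b g ->
  ccont a b (fun x => f x * g x).
Proof.
move=> cf cg x xab e e0.
pose A := nm (f x) + 1; pose B := nm (g x) + 1.
have A0 : 0 < A by rewrite ltr_wpDl ?nm_ge0.
have B0 : 0 < B by rewrite ltr_wpDl ?nm_ge0.
have [d d0 dP] := cf x xab (Num.min 1 (e / (2 * B)))
  (ltac:(rewrite lt_min ltr01 divr_gt0 // mulr_gt0 //)).
have [d' d'0 d'P] := cg x xab (e / (2 * A)) (ltac:(rewrite divr_gt0 // mulr_gt0 //)).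
exists (Num.min d d'); first by rewrite lt_min d0.
move=> y yab; rewrite lt_min => /andP[/dP-/(_ yab) P1 /d'P-/(_ yab) P2].
have -> : f y * g y - f x * g x = f y * (g y - g x) + (f y - f x) * g x by ring.
move: P1; rewrite le_min => /andP[P1 P1'].
have fy : nm (f y) <= A.
  have -> : f y = f x + (f y - f x) by ring.
  by rewrite (le_trans (nmD _ _)) // lerD2l.
have gx : nm (g x) <= B by rewrite lerDl.
rewrite (le_trans (nmD _ _)) // !nmM [leRHS]splitr lerD //.
  apply: le_trans (ler_pM (nm_ge0 _) (nm_ge0 _) fy P2) _.
  by have -> : A * (e / (2 * A)) = e / 2 by field; rewrite gt_eqF.
apply: le_trans (ler_pM (nm_ge0 _) (nm_ge0 _) P1' gx) _.
by have -> : e / (2 * B) * B = e / 2 by field; rewrite gt_eqF.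
Qed.

Lemma ccontN a b f : ccont a b f -> ccont a b (fun x => - f x).
Proof.
move=> cf; apply: (@ccont_eq _ _ (fun x => (-1) * f x)).
  by move=> x _; rewrite mulN1r.
by apply: ccontM => //; exact: ccont_cst.
Qed.

Lemma ccontB a b f g : ccont a b f -> ccont a b g ->
  ccont a b (fun x => f x - g x).
Proof. by move=> cf cg; apply: ccontD => //; exact: ccontN. Qed.

Lemma ccont_within a b (u : R -> R) :
  (forall x, a <= x <= b -> forall e : R, 0 < e ->
     exists2 d : R, 0 < d & forall y, a <= y <= b -> `|y - x| < d ->
       `|u y - u x| <= e) ->
  {within `[a, b], continuous u}.
Proof.
move=> cu; apply/subspace_continuousP => x /=; rewrite in_itv /= => xab.
apply/cvgrPdist_le => e e0; rewrite near_withinE.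
have [d d0 dP] := cu x xab e e0.
apply/nbhs_ballP; exists d => // y; rewrite /ball /= => yx; rewrite in_itv /= => yab.
by rewrite distrC dP // distrC.
Qed.

Lemma ccont_Re a b f : ccont a b f -> {within `[a, b], continuous (fun x => Re (f x))}.
Proof.
move=> cf; apply: ccont_within => x xab e e0; have [d d0 dP] := cf x xab e e0.
exists d => // y yab yx; apply: le_trans (dP y yab yx).
by rewrite /= -raddfB nm_Re.
Qed.

Lemma ccont_Im a b f : ccont a b f -> {within `[a, b], continuous (fun x => Im (f x))}.
Proof.
move=> cf; apply: ccont_within => x xab e e0; have [d d0 dP] := cf x xab e e0.
exists d => // y yab yx; apply: le_trans (dP y yab yx).
by rewrite /= -raddfB nm_Im.
Qed.

Lemma integrable_Re a b f : ccont a b f ->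
  mu.-integrable `[a, b] (EFin \o (fun x => Re (f x))).
Proof.
move=> /ccont_Re; apply: continuous_compact_integrable; exact: segment_compact.
Qed.

Lemma integrable_Im a b f : ccont a b f ->
  mu.-integrable `[a, b] (EFin \o (fun x => Im (f x))).
Proof.
move=> /ccont_Im; apply: continuous_compact_integrable; exact: segment_compact.
Qed.

Lemma cint_eq a b f g : (forall x, a <= x <= b -> f x = g x) ->
  cint a b f = cint a b g.
Proof.
move=> fg; rewrite /cint; congr (_ +i* _); apply: eq_Rintegral => x /set_mem /=;
  by rewrite in_itv /= => /fg ->.
Qed.

Lemma cintD a b f g : ccont a b f -> ccont a b g ->
  cint a b (fun x => f x + g x) = cint a b f + cint a b g.
Proof.
move=> cf cg; rewrite /cint.
under eq_Rintegral do rewrite raddfD /=.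
under [X in _ +i* X = _]eq_Rintegral do rewrite raddfD /=.
rewrite !RintegralD //=; first exact: integrable_Im; first exact: integrable_Im.
  exact: integrable_Re.
exact: integrable_Re.
Qed.

Lemma cintZ a b (c : C) f : ccont a b f ->
  cint a b (fun x => c * f x) = c * cint a b f.
Proof.
move=> cf; rewrite /cint; case: c => c1 c2.
have ReE x : Re ((c1 +i* c2) * f x) = c1 * Re (f x) - c2 * Im (f x).
  by case: (f x).
have ImE x : Im ((c1 +i* c2) * f x) = c1 * Im (f x) + c2 * Re (f x).
  by case: (f x).
under eq_Rintegral do rewrite ReE.
under [X in _ +i* X = _]eq_Rintegral do rewrite ImE.
have iR := integrable_Re cf; have iI := integrable_Im cf.
have iZ (u : R -> R) (r : R) : mu.-integrable `[a, b] (EFin \o u) ->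
    mu.-integrable `[a, b] (EFin \o (fun x => r * u x)).
  by move=> iu; have := integrableZl _ r iu; exact.
rewrite RintegralB ?RintegralD ?RintegralZl //=; do ?exact: iZ.
Qed.

Lemma cintN a b f : ccont a b f -> cint a b (fun x => - f x) = - cint a b f.
Proof.
move=> cf; rewrite -mulN1r -cintZ //; apply: cint_eq => x _; by rewrite mulN1r.
Qed.

Lemma cintB a b f g : ccont a b f -> ccont a b g ->
  cint a b (fun x => f x - g x) = cint a b f - cint a b g.
Proof. by move=> cf cg; rewrite cintD ?cintN //; exact: ccontN. Qed.

Lemma cint_cst a b (c : C) : a <= b -> cint a b (fun=> c) = (b - a)%:C * c.
Proof.
move=> ab; rewrite /cint !Rintegral_cst //= lebesgue_measure_itv /= lte_fin.
case: ltP => ab' /=; first by case: c => c1 c2; simpc; rewrite !(mulrC (b - a)).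
have -> : b - a = 0 by apply/eqP; rewrite subr_eq0 eq_le ab ab'.
by rewrite !mulr0 mul0r.
Qed.

Lemma cint_split a b c f : a <= c -> c <= b -> ccont a b f ->
  cint a b f = cint a c f + cint c b f.
Proof.
move=> ac cb cf; rewrite /cint.
have S (u : R -> R) : mu.-integrable `[a, b] (EFin \o u) ->
  \int[mu]_(x in `[a, b]) u x
    = \int[mu]_(x in `[a, c]) u x + \int[mu]_(x in `[c, b]) u x.
  move=> iu; apply/eqP; rewrite addrC -subr_eq; apply/eqP.
  rewrite Rintegral_itvB //.
  rewrite Rintegral_itv_obnd_cbnd //; apply: integrableS iu => //.
  by apply: subset_itvr; rewrite bnd_simp.
by rewrite !S //; [exact: integrable_Im|exact: integrable_Re].
Qed.

(** The factor 2 comes from bounding real and imaginary parts separately. *)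
Lemma cint_le a b f (M : R) : a <= b -> ccont a b f ->
  (forall x, a <= x <= b -> nm (f x) <= M) ->
  nm (cint a b f) <= 2 * M * (b - a).
Proof.
move=> ab cf fM.
have B (u : R -> R) : mu.-integrable `[a, b] (EFin \o u) ->
    (forall x, a <= x <= b -> `|u x| <= M) ->
    `|\int[mu]_(x in `[a, b]) u x| <= M * (b - a).
  move=> iu uM; apply: le_trans (le_normr_Rintegral _ iu) _ => //.
  have -> : M * (b - a) = \int[mu]_(x in `[a, b]) M.
    rewrite Rintegral_cst //= lebesgue_measure_itv /= lte_fin.
    case: ltP => ab' //=.
    have -> : b - a = 0 by apply/eqP; rewrite subr_eq0 eq_le ab ab'.
    by [].
  apply: le_Rintegral => //.
  - exact: integrable_abse iu.
  - apply: continuous_compact_integrable; first exact: segment_compact.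
    by apply: continuous_subspaceT => x; exact: cvg_cst.
rewrite (le_trans (nm_ReIm _)) //= -mulrA mulr_natl mulr2n lerD //.
  apply: (B (fun x => Re (f x))) => [|x xab]; first exact: integrable_Re.
  by apply: le_trans (nm_Re _) _; exact: fM.
apply: (B (fun x => Im (f x))) => [|x xab]; first exact: integrable_Im.
by apply: le_trans (nm_Im _) _; exact: fM.
Qed.

End ComplexIntegral.
(** * Derivatives along a real variable *)

Section RealVariable.
Context {R : realType}.
Local Notation C := R[i].
Local Notation mu := (@lebesgue_measure R).

(** The derivative of a function from [R] to [R[i]]. These are vector spaces over
    different fields, hence the estimate in place of a differential. *)
Definition rderiv (phi : R -> C) (t : R) (d : C) := forall e : R, 0 < e ->
  exists2 r : R, 0 < r & forall s : R, `|s| < r ->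
    nm (phi (t + s) - phi t - s%:C * d) <= e * `|s|.

Lemma estimate_is_derive (u : R -> R) (t d : R) :
  (forall e : R, 0 < e -> exists2 r : R, 0 < r & forall s : R, `|s| < r ->
    `|u (t + s) - u t - s * d| <= e * `|s|) ->
  is_derive t 1 u d.
Proof.
move=> du.
have L : (fun h : R => h^-1 *: ((u \o shift t) (h *: (1 : R)) - u t)) @ 0^' --> d.
  apply/cvgrPdist_le => e e0; have [r r0 rP] := du e e0.
  rewrite near_withinE; apply/nbhs_ballP; exists r => // s.
  rewrite /ball /= sub0r normrN => sr s0.
  have ns0 : 0 < `|s| by rewrite normr_gt0.
  have -> : d - s^-1 *: (u (s *: (1 : R) + t) - u t)
     = - (s^-1 * (u (t + s) - u t - s * d)).
    have -> : s *: (1 : R) + t = t + s by rewrite [_ *: _]mulr1 addrC.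
    by rewrite mulrBr mulrA mulVf // mul1r opprB.
  rewrite normrN normrM normfV ler_pdivrMl // [leRHS]mulrC.
  exact: rP.
split; last exact: cvg_lim L.
by apply: (cvgP d).
Qed.

Lemma rderiv_Re phi t d : rderiv phi t d ->
  is_derive t 1 (fun t => Re (phi t)) (Re d).
Proof.
move=> dphi; apply: estimate_is_derive => e e0; have [r r0 rP] := dphi e e0.
exists r => // s /rP; apply: le_trans.
have -> : s * Re d = Re (s%:C * d) by case: d {dphi rP} => d1 d2 /=; rewrite mul0r subr0.
by rewrite -!raddfB nm_Re.
Qed.

Lemma rderiv_Im phi t d : rderiv phi t d ->
  is_derive t 1 (fun t => Im (phi t)) (Im d).
Proof.
move=> dphi; apply: estimate_is_derive => e e0; have [r r0 rP] := dphi e e0.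
exists r => // s /rP; apply: le_trans.
have -> : s * Im d = Im (s%:C * d) by case: d {dphi rP} => d1 d2 /=; rewrite mul0r addr0.
by rewrite -!raddfB nm_Im.
Qed.

Lemma cint_FTC (phi psi : R -> C) (a b : R) : a < b ->
  ccont a b psi -> (forall t, a <= t <= b -> rderiv phi t (psi t)) ->
  cint a b psi = phi b - phi a.
Proof.
move=> ab cpsi dphi.
have FTC (u v : R -> R) : {within `[a, b], continuous v} ->
    (forall t, a <= t <= b -> is_derive t 1 u (v t)) ->
    \int[mu]_(x in `[a, b]) v x = u b - u a.
  move=> cv du.
  have cu t : a <= t <= b -> {for t, continuous u}.
    move=> /du [+ _] => /derivable1_diffP /differentiable_continuous; exact.
  rewrite /Rintegral (@continuous_FTC2 _ v u) //.
    split=> [t|  |].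
    - by rewrite in_itv /= => /andP[/ltW at_ /ltW tb]; case: (du t); rewrite ?at_.
    - by apply/cvg_at_right_filter/cu; rewrite lexx ltW.
    - by apply/cvg_at_left_filter/cu; rewrite lexx ltW.
  move=> t; rewrite in_itv /= => /andP[/ltW at_ /ltW tb].
  by rewrite derive1E; case: (du t); rewrite ?at_.
have E1 := FTC _ _ (ccont_Re cpsi) (fun t tab => rderiv_Re (dphi t tab)).
have E2 := FTC _ _ (ccont_Im cpsi) (fun t tab => rderiv_Im (dphi t tab)).
by rewrite /cint E1 E2; case: (phi b) (phi a) => ? ? [].
Qed.

(** Real and imaginary parts each satisfy the mean value theorem, at two points
    which differ in general: hence the factor 2. *)
Lemma mean_value_bound (phi psi : R -> C) (M : R) :
  (forall t : R, 0 <= t <= 1 -> rderiv phi t (psi t) /\ nm (psi t) <= M) ->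
  nm (phi 1 - phi 0) <= 2 * M.
Proof.
move=> dphi.
have B (u v : R -> R) : (forall t : R, 0 <= t <= 1 -> is_derive t 1 u (v t)) ->
    (forall t : R, 0 <= t <= 1 -> `|v t| <= M) -> `|u 1 - u 0| <= M.
  move=> du vM.
  have [||t] := @MVT _ u v 0 1 ltr01.
  - by move=> t; rewrite in_itv /= => /andP[/ltW t0 /ltW t1]; apply: du; rewrite t0.
  - apply: continuous_in_subspaceT => t /set_mem /=; rewrite in_itv /= => /du [+ _].
    by move=> /derivable1_diffP /differentiable_continuous; exact.
  rewrite in_itv /= => /andP[/ltW t0 /ltW t1] ->.
  by rewrite subr0 mulr1 vM // t0.
apply: le_trans (nm_ReIm _) _; rewrite mulr_natl mulr2n lerD //.
  rewrite raddfB /=; apply: (B (fun t => Re (phi t)) (fun t => Re (psi t))) => t /dphi [d dM].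
    exact: rderiv_Re.
  by rewrite (le_trans (nm_Re _)).
rewrite raddfB /=; apply: (B (fun t => Im (phi t)) (fun t => Im (psi t))) => t /dphi [d dM].
  exact: rderiv_Im.
by rewrite (le_trans (nm_Im _)).
Qed.

End RealVariable.
(** * Goursat's theorem for rectangles *)

Section Goursat.
Context {R : realType}.
Local Notation C := R[i].

Definition cderiv (F : C -> C) (z d : C) := forall e : R, 0 < e ->
  exists2 r : R, 0 < r & forall h : C, nm h < r ->
    nm (F (z + h) - F z - d * h) <= e * nm h.

Lemma cderiv_continuous F z d : cderiv F z d -> forall e : R, 0 < e ->
  exists2 r : R, 0 < r & forall h : C, nm h < r -> nm (F (z + h) - F z) <= e.
Proof.
move=> dF e e0; have [r r0 rP] := dF _ ltr01.
have D0 : 0 < nm d + 1 by rewrite ltr_wpDl ?nm_ge0.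
exists (Num.min r (e / (nm d + 1))); first by rewrite lt_min r0 divr_gt0.
move=> h; rewrite lt_min => /andP[/rP hr he].
have -> : F (z + h) - F z = (F (z + h) - F z - d * h) + d * h by ring.
rewrite (le_trans (nmD _ _)) // nmM.
move: hr he; rewrite ltr_pdivlMr //; have := nm_ge0 h; nra.
Qed.

Lemma nm_le_Re_Im (a b s : R) : `|a| <= s -> `|b| <= s -> nm (a +i* b : C) <= 2 * s.
Proof. by move=> ha hb; rewrite (le_trans (nm_ReIm _)) //= mulr_natl mulr2n lerD. Qed.

(** The integral of F(z) dz along the boundary of a rectangle, counterclockwise.
    Opposite sides are grouped under one integral: on a small rectangle each
    of the two integrands is then nearly constant. *)
Definition rect_integral (F : C -> C) (x0 x1 y0 y1 : R) : C :=
  cint x0 x1 (fun x => F (x +i* y0) - F (x +i* y1))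
  + 'i%C * cint y0 y1 (fun y => F (x1 +i* y) - F (x0 +i* y)).

Definition holomorphic_rect (F : C -> C) (x0 x1 y0 y1 : R) :=
  forall x y, x0 <= x <= x1 -> y0 <= y <= y1 -> exists d, cderiv F (x +i* y) d.

Section Rectangle.
Variables (F : C -> C) (X0 X1 Y0 Y1 : R).
Hypothesis HF : holomorphic_rect F X0 X1 Y0 Y1.

Lemma ccont_hor y x0 x1 : Y0 <= y <= Y1 -> X0 <= x0 -> x1 <= X1 ->
  ccont x0 x1 (fun x => F (x +i* y)).
Proof.
move=> yY x0X x1X x /andP[xx0 xx1] e e0; have [||d dF] := HF (x := x) (y := y) => //.
  by rewrite (le_trans x0X) // (le_trans xx1).
have [r r0 rP] := cderiv_continuous dF e0; exists r => // x' _ xx'.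
have -> : x' +i* y = (x +i* y) + (x' - x)%:C by simpc; rewrite addrC subrK.
by apply: rP; rewrite nmR.
Qed.

Lemma ccont_ver x y0 y1 : X0 <= x <= X1 -> Y0 <= y0 -> y1 <= Y1 ->
  ccont y0 y1 (fun y => F (x +i* y)).
Proof.
move=> xX y0Y y1Y y /andP[yy0 yy1] e e0; have [||d dF] := HF (x := x) (y := y) => //.
  by rewrite (le_trans y0Y) // (le_trans yy1).
have [r r0 rP] := cderiv_continuous dF e0; exists r => // y' _ yy'.
have -> : x +i* y' = (x +i* y) + 'i%C * (y' - y)%:C by simpc; rewrite addrC subrK.
by apply: rP; rewrite nmM nm_i mul1r nmR.
Qed.

Lemma rect_integral_splitx x0 m x1 y0 y1 : X0 <= x0 -> x0 <= m -> m <= x1 -> x1 <= X1 ->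
  Y0 <= y0 -> y0 <= y1 -> y1 <= Y1 ->
  rect_integral F x0 x1 y0 y1 = rect_integral F x0 m y0 y1 + rect_integral F m x1 y0 y1.
Proof.
move=> Xx0 x0m mx1 x1X Yy0 y01 y1Y.
have ch a b y : x0 <= a -> b <= x1 -> y0 <= y -> y <= y1 ->
    ccont a b (fun x => F (x +i* y)).
  by move=> ? ? ? ?; apply: ccont_hor => //; try (apply/andP; split); lra.
have cv x : x0 <= x -> x <= x1 -> ccont y0 y1 (fun y => F (x +i* y)).
  by move=> ? ?; apply: ccont_ver => //; apply/andP; split; lra.
have x01 := le_trans x0m mx1.
rewrite /rect_integral (@cint_split _ x0 x1 m) //; last by apply: ccontB; apply: ch.
rewrite !cintB //; try (by apply: cv); try (by apply: ch).
ring.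
Qed.

Lemma rect_integral_splity x0 x1 y0 m y1 : X0 <= x0 -> x0 <= x1 -> x1 <= X1 ->
  Y0 <= y0 -> y0 <= m -> m <= y1 -> y1 <= Y1 ->
  rect_integral F x0 x1 y0 y1 = rect_integral F x0 x1 y0 m + rect_integral F x0 x1 m y1.
Proof.
move=> Xx0 x01 x1X Yy0 y0m my1 y1Y.
have ch y : y0 <= y -> y <= y1 -> ccont x0 x1 (fun x => F (x +i* y)).
  by move=> ? ?; apply: ccont_hor => //; apply/andP; split; lra.
have cv a b x : y0 <= a -> b <= y1 -> x0 <= x -> x <= x1 ->
    ccont a b (fun y => F (x +i* y)).
  by move=> ? ? ? ?; apply: ccont_ver => //; try (apply/andP; split); lra.
have y01 := le_trans y0m my1.
rewrite /rect_integral (@cint_split _ y0 y1 m) //; last by apply: ccontB; apply: cv.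
rewrite !cintB //; try (by apply: cv); try (by apply: ch).
ring.
Qed.

(** Near a point with derivative d, the horizontal integrand is
    - i d (y1 - y0) and the vertical one d (x1 - x0), up to e times the diameter.
    The two constants contribute opposite values to the boundary integral. *)
Lemma Goursat_estimate p q (e : R) : X0 <= p <= X1 -> Y0 <= q <= Y1 -> 0 < e ->
  exists2 r : R, 0 < r & forall x0 x1 y0 y1 s : R, 2 * s < r ->
    X0 <= x0 -> x0 <= p <= x1 -> x1 <= X1 -> x1 - x0 <= s ->
    Y0 <= y0 -> y0 <= q <= y1 -> y1 <= Y1 -> y1 - y0 <= s ->
    nm (rect_integral F x0 x1 y0 y1) <= 16 * e * s ^+ 2.
Proof.
move=> pX qY e0; have [d dF] := HF pX qY; have [r r0 rP] := dF e e0.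
exists r => // x0 x1 y0 y1 s sr Xx0 /andP[x0p px1] x1X xs Yy0 /andP[y0q qy1] y1Y ys.
have est x y : x0 <= x <= x1 -> y0 <= y <= y1 ->
    nm (F (x +i* y) - F (p +i* q) - d * ((x - p) +i* (y - q))) <= e * (2 * s).
  move=> /andP[xx0 xx1] /andP[yy0 yy1].
  have hs : nm ((x - p) +i* (y - q) : C) <= 2 * s.
    by apply: nm_le_Re_Im; rewrite ler_norml; apply/andP; split; lra.
  have := rP _ (le_lt_trans hs sr).
  have -> : p +i* q + ((x - p) +i* (y - q)) = x +i* y.
    by simpc; congr (_ +i* _); ring.
  by move=> /le_trans; apply; rewrite ler_wpM2l // ltW.
have x01 : x0 <= x1 by lra.
have y01 : y0 <= y1 by lra.
have xin : (x0 <= x0 <= x1) * (x0 <= x1 <= x1) by rewrite !lexx x01.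
have yin : (y0 <= y0 <= y1) * (y0 <= y1 <= y1) by rewrite !lexx y01.
have ch y : y0 <= y <= y1 -> ccont x0 x1 (fun x => F (x +i* y)).
  by move=> /andP[? ?]; apply: ccont_hor => //; apply/andP; split; lra.
have cv x : x0 <= x <= x1 -> ccont y0 y1 (fun y => F (x +i* y)).
  by move=> /andP[? ?]; apply: ccont_ver => //; apply/andP; split; lra.
pose c1 : C := d * (0 +i* (y0 - y1)).
pose c2 : C := d * (x1 - x0)%:C.
have -> : rect_integral F x0 x1 y0 y1 =
    cint x0 x1 (fun x => F (x +i* y0) - F (x +i* y1) - c1)
    + 'i%C * cint y0 y1 (fun y => F (x1 +i* y) - F (x0 +i* y) - c2).
  rewrite (@cintB _ x0 x1 _ (fun=> c1)) ?(@cintB _ y0 y1 _ (fun=> c2)); first last.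
  - exact: ccont_cst.
  - by apply: ccontB; [exact: (ch y0 yin.1)|exact: (ch y1 yin.2)].
  - exact: ccont_cst.
  - by apply: ccontB; [exact: (cv x1 xin.2)|exact: (cv x0 xin.1)].
  rewrite !cint_cst // /rect_integral /c1 /c2.
  have -> : 0 +i* (y0 - y1) = - ('i%C * (y1 - y0)%:C) :> C.
    by apply/eqP; rewrite eq_complex /=; apply/andP; split; apply/eqP; ring.
  ring.
have B1 : nm (cint x0 x1 (fun x => F (x +i* y0) - F (x +i* y1) - c1))
    <= 2 * (4 * e * s) * (x1 - x0).
  apply: cint_le => //.
    apply: ccontB; last exact: ccont_cst.
    by apply: ccontB; [exact: (ch y0 yin.1)|exact: (ch y1 yin.2)].
  move=> x xx; have E1 := est _ _ xx yin.1; have E2 := est _ _ xx yin.2.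
  have -> : F (x +i* y0) - F (x +i* y1) - c1 =
    (F (x +i* y0) - F (p +i* q) - d * ((x - p) +i* (y0 - q)))
    - (F (x +i* y1) - F (p +i* q) - d * ((x - p) +i* (y1 - q))).
    have -> : c1 = d * ((x - p) +i* (y0 - q)) - d * ((x - p) +i* (y1 - q)).
      by rewrite -mulrBr /c1; congr (_ * _); simpc; congr (_ +i* _); ring.
    ring.
  by rewrite (le_trans (nmB _ _)) //; lra.
have B2 : nm (cint y0 y1 (fun y => F (x1 +i* y) - F (x0 +i* y) - c2))
    <= 2 * (4 * e * s) * (y1 - y0).
  apply: cint_le => //.
    apply: ccontB; last exact: ccont_cst.
    by apply: ccontB; [exact: (cv x1 xin.2)|exact: (cv x0 xin.1)].
  move=> y yy; have E1 := est _ _ xin.1 yy; have E2 := est _ _ xin.2 yy.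
  have -> : F (x1 +i* y) - F (x0 +i* y) - c2 =
    (F (x1 +i* y) - F (p +i* q) - d * ((x1 - p) +i* (y - q)))
    - (F (x0 +i* y) - F (p +i* q) - d * ((x0 - p) +i* (y - q))).
    have -> : c2 = d * ((x1 - p) +i* (y - q)) - d * ((x0 - p) +i* (y - q)).
      by rewrite -mulrBr /c2; congr (_ * _); simpc; congr (_ +i* _); ring.
    ring.
  by rewrite (le_trans (nmB _ _)) //; lra.
rewrite (le_trans (nmD _ _)) // nmM nm_i mul1r.
have s0 : 0 <= s by rewrite (le_trans _ xs) // subr_ge0.
have es0 : 0 <= 2 * (4 * e * s) by rewrite !mulr_ge0 // ltW.
have -> : 16 * e * s ^+ 2 = 2 * (4 * e * s) * s + 2 * (4 * e * s) * s by ring.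
by rewrite lerD //; [apply: le_trans B1 _|apply: le_trans B2 _]; rewrite ler_wpM2l.
Qed.

End Rectangle.
End Goursat.
Section GoursatTheorem.
Context {R : realType}.
Local Notation C := R[i].

Lemma nested_intervals (a b : nat -> R) : (forall k, a k <= a k.+1) ->
  (forall k, b k.+1 <= b k) -> (forall k, a k <= b k) ->
  exists p, forall k, a k <= p <= b k.
Proof.
move=> ai bi ab.
have aM : {homo a : m n / (m <= n)%N >-> m <= n}.
  by apply: homo_leq => // ? ? ?; exact: le_trans.
have bM : {homo b : m n / (m <= n)%N >-> n <= m}.
  by apply: homo_leq => // ? ? ? ? /le_trans; exact.
have amb m k : a m <= b k.
  have [mk|km] := leqP m k; first exact: le_trans (aM _ _ mk) (ab _).
  exact: le_trans (ab _) (bM _ _ (ltnW km)).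
have hs : has_sup (range a).
  by split; [exists (a 0%N); exists 0%N|exists (b 0%N) => _ [m _ <-]].
exists (sup (range a)) => k; apply/andP; split.
  by apply: sup_upper_bound => //; exists k.
by apply: ge_sup; [exists (a 0%N); exists 0%N|move=> _ [m _ <-]].
Qed.

Lemma small_pow2 (L r : R) : 0 < r -> exists k, L / 2 ^+ k < r.
Proof.
move=> r0; exists (Num.Def.archi_bound (`|L| / r)).
set k := Num.Def.archi_bound _.
rewrite ltr_pdivrMr ?exprn_gt0 // mulrC -ltr_pdivrMr //.
have Lr : `|L| / r < k%:R by apply: archi_boundP; rewrite divr_ge0 // ltW.
apply: le_lt_trans (lt_trans Lr _).
  by rewrite ler_wpM2r ?invr_ge0 ?(ltW r0) // ler_norm.
by rewrite -natrX ltr_nat ltn_expl.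
Qed.

(** The boundary integrals of the four quarters add up to that of the rectangle,
    so one of them has at least a quarter of its modulus. *)
Lemma rect_integral_quarter (F : C -> C) (X0 X1 Y0 Y1 x y a b E : R) :
  holomorphic_rect F X0 X1 Y0 Y1 -> 0 <= a -> 0 <= b ->
  X0 <= x -> x + (a + a) <= X1 -> Y0 <= y -> y + (b + b) <= Y1 ->
  E + E + (E + E) <= nm (rect_integral F x (x + (a + a)) y (y + (b + b))) ->
  exists x' y', [/\ x <= x', x' + a <= x + (a + a), y <= y',
    y' + b <= y + (b + b) & E <= nm (rect_integral F x' (x' + a) y' (y' + b))].
Proof.
move=> HF a0 b0 Xx xX Yy yY EP; rewrite !addrA in xX yY EP *.
have [N1|N1] := leP E (nm (rect_integral F x (x + a) y (y + b))).
  by exists x, y; rewrite lexx N1 !lerDl.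
have [N2|N2] := leP E (nm (rect_integral F (x + a) (x + a + a) y (y + b))).
  by exists (x + a), y; rewrite !lexx N2 !lerDl.
have [N3|N3] := leP E (nm (rect_integral F x (x + a) (y + b) (y + b + b))).
  by exists x, (y + b); rewrite !lexx N3 !lerDl.
have [N4|N4] := leP E (nm (rect_integral F (x + a) (x + a + a) (y + b) (y + b + b))).
  by exists (x + a), (y + b); rewrite !lexx N4 !lerDl.
have xa : x + a <= x + a + a by rewrite lerDl.
have yb : y + b <= y + b + b by rewrite lerDl.
have xx : x <= x + a by rewrite lerDl.
have yy : y <= y + b by rewrite lerDl.
have xaX := le_trans xa xX; have Xxa := le_trans Xx xx.
have yY2 := le_trans yb yY; have Yyb := le_trans Yy yy.
exfalso; move: EP; apply/negP; rewrite -ltNge.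
have Sx := rect_integral_splitx HF Xx xx xa xX Yy (le_trans yy yb) yY.
have Sy := rect_integral_splity HF.
rewrite Sx (Sy x (x + a) y (y + b)) // (Sy (x + a) (x + a + a) y (y + b)) // -addrA addrACA.
apply: le_lt_trans (nmD _ _) (ltrD _ _).
  exact: le_lt_trans (nmD _ _) (ltrD N1 N2).
exact: le_lt_trans (nmD _ _) (ltrD N3 N4).
Qed.

(** Bisection: if the boundary integral has modulus E > 0, nested rectangles of
    sides divided by 2^k have boundary integrals of modulus at least E / 4^k.
    At their common point [Goursat_estimate] bounds these by a small constant
    times 4^-k. *)
Theorem Goursat (F : C -> C) (X0 X1 Y0 Y1 : R) : X0 <= X1 -> Y0 <= Y1 ->
  holomorphic_rect F X0 X1 Y0 Y1 -> rect_integral F X0 X1 Y0 Y1 = 0.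
Proof.
move=> X01 Y01 HF; apply: nm_eq0; apply/eqP; rewrite eq_le nm_ge0 andbT leNgt.
apply/negP => E0; set E := nm _ in E0.
pose X := X1 - X0; pose Y := Y1 - Y0.
have X_ge0 : 0 <= X by rewrite subr_ge0.
have Y_ge0 : 0 <= Y by rewrite subr_ge0.
pose w k := X / 2 ^+ k; pose h k := Y / 2 ^+ k.
have p2 k : 0 < 2 ^+ k :> R by rewrite exprn_gt0.
have wS k : w k = w k.+1 + w k.+1.
  by rewrite /w exprS; field; rewrite gt_eqF.
have hS k : h k = h k.+1 + h k.+1.
  by rewrite /h exprS; field; rewrite gt_eqF.
have w0 k : 0 <= w k by rewrite divr_ge0 // ltW.
have h0 k : 0 <= h k by rewrite divr_ge0 // ltW.
pose P k (s : R * R) := [/\ X0 <= s.1, s.1 + w k <= X1, Y0 <= s.2, s.2 + h k <= Y1 &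
  E / 4 ^+ k <= nm (rect_integral F s.1 (s.1 + w k) s.2 (s.2 + h k))].
pose sub k (s s' : R * R) := [/\ s.1 <= s'.1, s'.1 + w k.+1 <= s.1 + w k,
   s.2 <= s'.2 & s'.2 + h k.+1 <= s.2 + h k].
have step k s : P k s -> exists s', P k.+1 s' /\ sub k s s'.
  case: s => x y [/= Xx xX Yy yY EP]; rewrite wS hS in xX yY EP.
  have [|x' [y' [xx' x'x yy' y'y EP']]] := rect_integral_quarter HF (w0 k.+1) (h0 k.+1)
      Xx xX Yy yY (E := E / 4 ^+ k.+1).
    apply: le_trans EP; rewrite le_eqVlt; apply/orP; left; apply/eqP.
    by rewrite exprS; field; rewrite gt_eqF // exprn_gt0.
  exists (x', y'); rewrite /P /sub /= (wS k) (hS k); split; split => //.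
  - exact: le_trans xx'.
  - exact: le_trans x'x _.
  - exact: le_trans yy'.
  - exact: le_trans y'y _.
have /choice [nx nxP] : forall ks : nat * (R * R), exists s',
    P ks.1 ks.2 -> P ks.1.+1 s' /\ sub ks.1 ks.2 s'.
  move=> [k s] /=; have [/step [s' ?]|NP] := pselect (P k s); first by exists s'.
  by exists s.
(* lower left corners of the nested rectangles *)
pose fix S k : R * R := if k is k'.+1 then nx (k', S k') else (X0, Y0).
have SP k : P k (S k).
  elim: k => [|k IHk]; last by case: (nxP (k, S k) IHk).
  have W0 : X0 + w 0%N = X1 by rewrite /w expr0 divr1 /X addrC subrK.
  have H0 : Y0 + h 0%N = Y1 by rewrite /h expr0 divr1 /Y addrC subrK.
  by rewrite /P [S _]/= [_.1]/= [_.2]/= W0 H0 expr0 divr1; split.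
have Ssub k : sub k (S k) (S k.+1) by case: (nxP (k, S k) (SP k)).
have [||k|p pP] := @nested_intervals (fun k => (S k).1) (fun k => (S k).1 + w k).
- by move=> k; case: (Ssub k).
- by move=> k; case: (Ssub k).
- by rewrite lerDl.
have [||k|q qP] := @nested_intervals (fun k => (S k).2) (fun k => (S k).2 + h k).
- by move=> k; case: (Ssub k).
- by move=> k; case: (Ssub k).
- by rewrite lerDl.
have pX : X0 <= p <= X1.
  by have [A B _ _ _] := SP 0%N; have /andP[C' D] := pP 0%N; rewrite (le_trans A) ?(le_trans D).
have qY : Y0 <= q <= Y1.
  by have [_ _ A B _] := SP 0%N; have /andP[C' D] := qP 0%N; rewrite (le_trans A) ?(le_trans D).
pose L := X + Y + 1.
have L0 : 0 < L by rewrite ltr_wpDl // addr_ge0.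
have e0 : 0 < E / (32 * L ^+ 2) by rewrite divr_gt0 // mulr_gt0 // exprn_gt0.
have [r r0 rP] := Goursat_estimate HF pX qY e0.
have [k kr] := small_pow2 (2 * L) r0.
have [A1 A2 A3 A4 A5] := SP k.
have XL : X <= L by rewrite /L -addrA lerDl addr_ge0.
have YL : Y <= L by rewrite /L addrAC addrC lerDl addr_ge0.
have B : nm (rect_integral F (S k).1 ((S k).1 + w k) (S k).2 ((S k).2 + h k))
    <= 16 * (E / (32 * L ^+ 2)) * (L / 2 ^+ k) ^+ 2.
  apply: rP => //.
  - by rewrite mulrA.
  - by rewrite addrAC subrr add0r /w ler_wpM2r ?invr_ge0 ?(ltW (p2 k)).
  - by rewrite addrAC subrr add0r /h ler_wpM2r ?invr_ge0 ?(ltW (p2 k)).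
have := le_trans A5 B.
have -> : 16 * (E / (32 * L ^+ 2)) * (L / 2 ^+ k) ^+ 2 = E / 4 ^+ k / 2.
  have -> : (4 : R) = 2 ^+ 2 by ring.
  by rewrite exprAC; field; rewrite !gt_eqF.
have : 0 < E / 4 ^+ k by rewrite divr_gt0 // exprn_gt0.
by rewrite leNgt ltr_pdivrMr // => G; rewrite ltr_pMr // ltr1n.
Qed.

End GoursatTheorem.
(** * The mean value property on circles *)

Section ComplexExponential.
Context {R : realType}.
Local Notation C := R[i].

Lemma is_derive_estimate (u : R -> R) (t d : R) : is_derive t 1 u d ->
  forall e : R, 0 < e -> exists2 r : R, 0 < r & forall s : R, `|s| < r ->
    `|u (t + s) - u t - s * d| <= e * `|s|.
Proof.
move=> [du ud] e e0; move: du; rewrite /derivable => /cvg_ex [l ul].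
have ld : l = d by rewrite -ud; apply/esym/cvg_lim.
have := ul; rewrite ld => /cvgrPdist_le /(_ e e0).
rewrite near_withinE => /nbhs_ballP [r r0 rP]; exists r => // s sr.
have [->|s0] := eqVneq s 0; first by rewrite addr0 mul0r subr0 subrr normr0 mulr0.
have := rP s; rewrite /ball /= sub0r normrN => /(_ sr s0).
have ns0 : 0 < `|s| by rewrite normr_gt0.
have -> : d - s^-1 *: (u (s *: (1 : R) + t) - u t)
     = - (s^-1 * (u (t + s) - u t - s * d)).
  have -> : s *: (1 : R) + t = t + s by rewrite [_ *: _]mulr1 addrC.
  by rewrite mulrBr mulrA mulVf // mul1r opprB.
by rewrite normrN normrM normfV ler_pdivrMl // [_ * e]mulrC.
Qed.

Definition cexp (w : C) : C :=
  (expR (Re w) * cos (Im w)) +i* (expR (Re w) * sin (Im w)).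

Definition cis (t : R) : C := cos t +i* sin t.

Lemma nm_cis t : nm (cis t) = 1.
Proof. by rewrite /nm normc_def /= cos2Dsin2 sqrtr1. Qed.

Lemma cexpE (a b : R) : cexp (a +i* b) = (expR a)%:C * cis b.
Proof. by rewrite /cexp /cis; simpc. Qed.

Lemma nm_cexp w : nm (cexp w) = expR (Re w).
Proof. by case: w => a b; rewrite cexpE nmM nm_cis mulr1 nmR ger0_norm // expR_ge0. Qed.

Lemma cexp0 : cexp 0 = 1.
Proof. by rewrite /cexp /= expR0 cos0 sin0 !mul1r. Qed.

Lemma cexpD z w : cexp (z + w) = cexp z * cexp w.
Proof.
case: z w => [a b] [c d]; rewrite /cexp /=; simpc; rewrite expRD cosD sinD.
by congr (_ +i* _); ring.
Qed.

Lemma cexp_period x : cexp (x +i* (pi *+ 2)) = cexp (x +i* 0).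
Proof. by rewrite /cexp /= cos2pi sin2pi cos0 sin0. Qed.

(** With h = a + i b, the error exp h - 1 - h is expressed by the three real errors
    e^a - 1 - a, cos b - 1 and sin b - b, each of which is small compared with h. *)
Lemma cderiv_cexp0 : cderiv (cexp : C -> C) 0 1.
Proof.
move=> e e0; have [m [m0 m1 me]] : exists m : R, [/\ 0 < m, m <= 1 & m <= e / 8].
  by exists (Num.min 1 (e / 8)); rewrite lt_min !ge_min !lexx orbT ltr01 divr_gt0.
have [r1 r10 h1] := is_derive_estimate (is_derive_expR 0) m0.
have [r2 r20 h2] := is_derive_estimate (is_derive_cos 0) m0.
have [r3 r30 h3] := is_derive_estimate (is_derive_sin 0) m0.
exists (Num.min (Num.min r1 r2) (Num.min r3 m)).
  by rewrite !lt_min r10 r20 r30 m0.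
case=> a b; rewrite !lt_min => /andP[/andP[l1 l2] /andP[l3 lm]].
have aN := nm_Re (a +i* b); have bN := nm_Im (a +i* b); rewrite /= in aN bN.
set N := nm _ in l1 l2 l3 lm aN bN *; have N0 : 0 <= N by exact: nm_ge0.
have := h1 a (le_lt_trans aN l1); have := h2 b (le_lt_trans bN l2).
have := h3 b (le_lt_trans bN l3).
rewrite !add0r expR0 cos0 sin0 oppr0 mulr0 !mulr1 !subr0 ?addr0.
move=> S1 C1 E1; rewrite cexp0 mul1r.
have -> : cexp (a +i* b) - 1 - (a +i* b) =
    (expR a * cos b - 1 - a) +i* (expR a * sin b - b).
  by apply/eqP; rewrite eq_complex /= !subr0 !eqxx.
apply: le_trans (nm_ReIm _) _; rewrite /=.
set A := expR a - 1 - a in E1; set c := cos b - 1 in C1; set s := sin b - b in S1.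
have -> : expR a * cos b - 1 - a = A * cos b + c + a * c.
  by rewrite /A /c; ring.
have -> : expR a * sin b - b = (A + a) * sin b + s.
  by rewrite /A /s; ring.
have AN : `|A| <= m * N by rewrite (le_trans E1) // ler_wpM2l // ltW.
have cN : `|c| <= m * N by rewrite (le_trans C1) // ler_wpM2l // ltW.
have sN : `|s| <= m * N by rewrite (le_trans S1) // ler_wpM2l // ltW.
have mN1 : m * N <= N by rewrite ler_piMl.
have N1 : N <= 1 by rewrite (le_trans (ltW lm)).
have B1 : `|A * cos b + c + a * c| <= m * N + m * N + m * N.
  rewrite !(le_trans (ler_normD _ _)) //; apply: lerD.
    rewrite (le_trans (ler_normD _ _)) //; apply: lerD => //.
    by rewrite normrM (le_trans _ AN) // ler_piMr // cos_max.
  by rewrite normrM (le_trans _ cN) // ler_piMl // (le_trans aN).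
have sb : `|sin b| <= 2 * N.
  have -> : sin b = s + b by rewrite /s subrK.
  rewrite (le_trans (ler_normD _ _)) // mulr_natl mulr2n; apply: lerD => //.
  exact: le_trans mN1.
have Aa : `|A + a| <= 2 * N.
  rewrite (le_trans (ler_normD _ _)) // mulr_natl mulr2n; apply: lerD => //.
  exact: le_trans mN1.
have B2 : `|(A + a) * sin b + s| <= 2 * N * (2 * m) + m * N.
  rewrite (le_trans (ler_normD _ _)) //; apply: lerD => //.
  rewrite normrM; apply: ler_pM => //; apply: le_trans sb _.
  by rewrite ler_wpM2l // ltW.
apply: le_trans (lerD B1 B2) _.
have -> : m * N + m * N + m * N + (2 * N * (2 * m) + m * N) = 8 * m * N by ring.
by rewrite ler_wpM2r // mulrC -ler_pdivlMr.
Qed.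

Lemma cderiv_cexp w : cderiv (cexp : C -> C) w (cexp w).
Proof.
move=> e e0; have n0 : 0 < nm (cexp w) by rewrite nm_cexp expR_gt0.
have [r r0 rP] := cderiv_cexp0 (divr_gt0 e0 n0); exists r => // h /rP.
rewrite add0r cexp0 mul1r cexpD => B.
have -> : cexp w * cexp h - cexp w - cexp w * h = cexp w * (cexp h - 1 - h) by ring.
by rewrite nmM mulrC -ler_pdivlMr // mulrAC.
Qed.

Lemma cderiv_comp (k F : C -> C) w d d' : cderiv F w d -> cderiv k (F w) d' ->
  cderiv (k \o F) w (d' * d).
Proof.
move=> dF dk e e0.
pose D := nm d + 1; have D0 : 0 < D by rewrite ltr_wpDl ?nm_ge0.
pose D' := nm d' + 1; have D'0 : 0 < D' by rewrite ltr_wpDl ?nm_ge0.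
have [r1 r10 h1] := dk _ (divr_gt0 e0 (mulr_gt0 (ltr0n R 2) D0) : 0 < e / (2 * D)).
have [r2 r20 h2] := dF (Num.min 1 (e / (2 * D')))
  (ltac:(rewrite lt_min ltr01 divr_gt0 // mulr_gt0 //)).
exists (Num.min r2 (r1 / D)); first by rewrite lt_min r20 divr_gt0.
move=> h; rewrite lt_min ltr_pdivlMr // => /andP[/h2 B hr1].
move: B; set x := F (w + h) - F w => B.
have N0 := nm_ge0 h.
have B1 : nm (x - d * h) <= nm h by apply: le_trans B _; rewrite ler_piMl // ge_min lexx.
have B2 : nm (x - d * h) <= e / (2 * D') * nm h.
  by apply: le_trans B _; rewrite ler_wpM2r // ge_min lexx orbT.
have xD : nm x <= D * nm h.
  have -> : x = d * h + (x - d * h) by ring.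
  by rewrite (le_trans (nmD _ _)) // nmM /D mulrDl mul1r lerD2l.
rewrite mulrC in hr1; have := h1 x (le_lt_trans xD hr1).
have -> : F w + x = F (w + h) by rewrite /x addrC subrK.
move=> B3 /=.
have -> : k (F (w + h)) - k (F w) - d' * d * h =
  (k (F (w + h)) - k (F w) - d' * x) + d' * (x - d * h) by ring.
rewrite (le_trans (nmD _ _)) //.
have -> : e * nm h = e / (2 * D) * (D * nm h) + D' * (e / (2 * D') * nm h).
  by field; rewrite !gt_eqF.
apply: lerD.
  by apply: le_trans B3 _; rewrite ler_wpM2l // ltW // divr_gt0 // mulr_gt0.
by rewrite nmM; apply: ler_pM; rewrite ?nm_ge0 // lerDl.
Qed.

Lemma ccont_cis (a b : R) : ccont a b (cis : R -> C).
Proof.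
move=> x _ e e0; have [r r0 rP] := cderiv_continuous (@cderiv_cexp (0 +i* x)) e0.
exists r => // y _ yx.
have E z : cis z = cexp (0 +i* z) by rewrite cexpE expR0 mul1r.
have -> : cis y = cexp (0 +i* x + 'i%C * (y - x)%:C).
  by rewrite E; congr cexp; simpc; rewrite addrC subrK.
by rewrite (E x); apply: rP; rewrite nmM nm_i mul1r nmR.
Qed.

(** The circles around 0 are the images under exp of the vertical segments of
    length 2 pi. The horizontal sides of a rectangle with such vertical sides
    have the same image under exp, so by Goursat's theorem the average of k over
    a circle is independent of the radius; small circles give k(0). Continuity
    at the centre is what a difference quotient has there. *)
Lemma circle_mean_value (k : C -> C) (rho : R) : 0 < rho ->
  (forall u, u != 0 -> nm u <= rho -> exists d, cderiv k u d) ->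
  (forall e : R, 0 < e -> exists2 r : R, 0 < r &
     forall u, nm u < r -> nm (k u - k 0) <= e) ->
  cint 0 (pi *+ 2) (fun t => k (rho%:C * cis t)) = (pi *+ 2 : R)%:C * k 0.
Proof.
move=> rho0 dk ck; set T : R := pi *+ 2.
have T0 : 0 < T by rewrite /T mulrn_wgt0 // pi_gt0.
have perT x : cexp (x +i* T) = cexp (x +i* 0) by exact: cexp_period.
clearbody T.
pose F := k \o cexp.
have Fhol x0 x1 : x1 <= ln rho -> holomorphic_rect F x0 x1 0 T.
  move=> x1r x y /andP[_ xx1] _.
  have E : nm (cexp (x +i* y)) = expR x by rewrite nm_cexp.
  have [||d dkd] := dk (cexp (x +i* y)).
  - by apply/eqP => z0; move: (expR_gt0 x); rewrite -E z0 nm0 ltxx.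
  - by rewrite E -(@lnK _ rho) ?posrE // ler_expR (le_trans xx1).
  by exists (d * cexp (x +i* y)); apply: cderiv_comp => //; exact: cderiv_cexp.
have cF x : x <= ln rho -> ccont 0 T (fun t => F (x +i* t)).
  by move=> xr; apply: (ccont_ver (Fhol x x xr)); rewrite ?lexx.
have I x : x <= ln rho ->
    cint 0 T (fun t => F (x +i* t)) = cint 0 T (fun t => F (ln rho +i* t)).
  move=> xr; have := Goursat xr (ltW T0) (Fhol x _ (lexx _)); rewrite /rect_integral.
  rewrite (@cint_eq _ x _ _ (fun=> 0)); last first.
    by move=> z _; rewrite /F /= perT subrr.
  rewrite (cint_cst _ xr) mulr0 add0r (cintB (cF _ (lexx _)) (cF _ xr)).
  move=> /(congr1 nm); rewrite nmM nm_i mul1r nm0 => /nm_eq0.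
  by move=> /subr0_eq ->.
have -> : cint 0 T (fun t => k (rho%:C * cis t)) = cint 0 T (fun t => F (ln rho +i* t)).
  by apply: cint_eq => t _; rewrite /F /= cexpE lnK ?posrE.
apply/eqP; rewrite -subr_eq0; apply/eqP/nm_eq0; apply/eqP; rewrite eq_le nm_ge0 andbT.
apply/ler_addgt0Pl => e e0; rewrite addr0.
have e'0 : 0 < e / (2 * T) by rewrite divr_gt0 // mulr_gt0.
have [r r0 rP] := ck _ e'0.
(* a circle on which k is close to its value at 0 *)
pose s := Num.min (r / 2) rho; have s0 : 0 < s by rewrite lt_min divr_gt0.
have sr : s < r by rewrite gt_min ltr_pdivrMr // ltr_pMr // ltr1n.
have lns : ln s <= ln rho by rewrite ler_ln ?posrE // ge_min lexx orbT.
rewrite -(I _ lns).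
have -> : T%:C * k 0 = cint 0 T (fun=> k 0) by rewrite cint_cst ?(ltW T0) // subr0.
rewrite -(cintB (cF _ lns)); last exact: ccont_cst.
apply: le_trans (@cint_le _ 0 T _ (e / (2 * T)) (ltW T0) _ _) _.
- by apply: ccontB; [exact: cF|exact: ccont_cst].
- by move=> t _; apply: rP; rewrite nm_cexp /= lnK ?posrE.
- by rewrite subr0 le_eqVlt; apply/orP; left; apply/eqP; field; rewrite gt_eqF.
Qed.

End ComplexExponential.
(** * Cauchy estimates in a disc *)

Section CauchyEstimates.
Context {R : realType}.
Local Notation C := R[i].
Local Notation T := (pi *+ 2 : R).
Implicit Types (f D F : C -> C) (z : C).

Lemma twopi_gt0 : 0 < T.
Proof. by rewrite mulrn_wgt0 // pi_gt0. Qed.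

Lemma cderiv_differentiable f z d : cderiv f z d -> differentiable f z.
Proof.
move=> df; have [] // := @estimate_differentiable _ _ _ f (fun h => d * h) z (nm d).
- by move=> a x y; rewrite mulrDr; congr (_ + _); rewrite mulrCA.
- by move=> v; rewrite nmM.
Qed.

Lemma cderiv_id z : cderiv (fun u => u) z 1.
Proof.
move=> e e0; exists 1 => // h _.
have -> : z + h - z - 1 * h = 0 by ring.
by rewrite nm0 mulr_ge0 ?nm_ge0 // ltW.
Qed.

Lemma differentiable_cderiv f z : differentiable f z -> cderiv f z ('d f z 1).
Proof.
move=> df e e0; have [r r0 rP] := differentiable_estimate df e0; exists r => // h /rP.
have -> : 'd f z h = 'd f z 1 * h by rewrite -[h in LHS]mulr1 linearZ mulrC.
by [].
Qed.

Lemma cderiv_local f g z d (r : R) : 0 < r ->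
  (forall h, nm h < r -> f (z + h) = g (z + h)) -> cderiv f z d -> cderiv g z d.
Proof.
move=> r0 fg df e e0; have [s s0 sP] := df e e0; exists (Num.min r s).
  by rewrite lt_min r0.
move=> h; rewrite lt_min => /andP[hr hs]; rewrite -fg // -{2}[z]addr0 -fg ?nm0 //.
by rewrite addr0; exact: sP.
Qed.

Lemma cderiv_line F z v (t : R) d : cderiv F (z + t%:C * v) d ->
  rderiv (fun t : R => F (z + t%:C * v)) t (d * v).
Proof.
move=> dF e e0; have V0 : 0 < nm v + 1 by rewrite ltr_wpDl ?nm_ge0.
have [r r0 rP] := dF _ (divr_gt0 e0 V0); exists (r / (nm v + 1)); first exact: divr_gt0.
move=> s; rewrite ltr_pdivlMr // => sr.
have sv : nm (s%:C * v) <= `|s| * (nm v + 1) by rewrite nmM nmR ler_wpM2l // lerDl.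
have := rP _ (le_lt_trans sv sr).
have -> : z + t%:C * v + s%:C * v = z + (t + s)%:C * v by rewrite rmorphD /= mulrDl addrA.
rewrite mulrCA mulrA => /le_trans; apply.
apply: le_trans (ler_wpM2l (ltW (divr_gt0 e0 V0)) sv) _.
by rewrite mulrCA mulfVK ?gt_eqF // mulrC.
Qed.

Lemma ccont_comp F (phi : R -> C) (a b : R) : ccont a b phi ->
  (forall t, a <= t <= b -> exists d, cderiv F (phi t) d) ->
  ccont a b (fun t => F (phi t)).
Proof.
move=> cphi dF t tab e e0; have [d dFt] := dF t tab.
have [r r0 rP] := cderiv_continuous dFt e0.
have [|s s0 sP] := cphi t tab (r / 2); first by rewrite divr_gt0.
exists s => // y yab /(sP _ yab) E.
have -> : phi y = phi t + (phi y - phi t) by rewrite addrC subrK.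
by apply: rP; apply: le_lt_trans E _; rewrite ltr_pdivrMr // ltr_pMr // ltr1n.
Qed.

Lemma circle_neq0 (rho t : R) : 0 < rho -> rho%:C * cis t != 0 :> C.
Proof.
move=> rho0; apply/eqP => /(congr1 nm); rewrite nmM nm_cis mulr1 nmR nm0 => /eqP.
by rewrite normr_eq0 gt_eqF.
Qed.

Lemma nm_circle (rho t : R) : 0 < rho -> nm (rho%:C * cis t : C) = rho.
Proof. by move=> r0; rewrite nmM nm_cis mulr1 nmR gtr0_norm. Qed.

Lemma ccont_circle (rho a b : R) z : ccont a b (fun t => z + rho%:C * cis t).
Proof.
by apply: ccontD; [exact: ccont_cst|apply: ccontM; [exact: ccont_cst|exact: ccont_cis]].
Qed.

Lemma ccont_circle_inv (rho a b : R) : 0 < rho ->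
  ccont a b (fun t => (rho%:C * cis t)^-1).
Proof.
move=> r0; apply: (@ccont_eq _ _ _ (fun t => (0 + rho%:C * cis t)^-1)).
  by move=> x _; rewrite add0r.
apply: ccont_comp; first exact: ccont_circle.
move=> t _; eexists; apply: differentiable_cderiv.
apply: differentiableV; last by rewrite add0r circle_neq0.
exact: cderiv_differentiable (cderiv_id _).
Qed.

(** The mean value property of the difference quotient u -> (f(z+u) - f(z)) / u,
    whose value at 0 is d. In this form the derivative depends on differences
    of f only, so a Lipschitz bound on f gives one on its derivative. *)
Lemma deriv_formula f z d (rho : R) : 0 < rho -> cderiv f z d ->
  (forall u, nm u <= rho -> exists d', cderiv f (z + u) d') ->
  cint 0 T (fun t => (f (z + rho%:C * cis t) - f z) * (rho%:C * cis t)^-1)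
    = T%:C * d.
Proof.
move=> rho0 df dfu.
pose q u := (f (z + u) - f z) * u^-1.
(* the difference quotient, extended continuously to 0 *)
pose k u := if u == 0 then d else q u.
have -> : T%:C * d = T%:C * k 0 by rewrite /k eqxx.
rewrite -(circle_mean_value rho0); first last.
- move=> e e0; have [r r0 rP] := df e e0; exists r => // u ur.
  rewrite /k eqxx; case: eqVneq => [_|u0]; first by rewrite subrr nm0 ltW.
  have -> : q u - d = (f (z + u) - f z - d * u) * u^-1.
    by rewrite mulrBl mulfK.
  by rewrite nmM nmV ler_pdivrMr ?nm_gt0 // rP.
- move=> u u0 ur; have [d' dfz] := dfu u ur.
  have dfzu : differentiable (fun v => f (z + v)) u.
    apply: (@cderiv_differentiable _ _ d') => e e0; have [s s0 sP] := dfz e e0.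
    by exists s => // h /sP; rewrite addrA.
  have dq : differentiable q u.
    exact: differentiableM (differentiableB dfzu (differentiable_cst _ _))
      (differentiableV (cderiv_differentiable (cderiv_id u)) u0).
  eexists; apply: (@cderiv_local q) (differentiable_cderiv dq); first exact: nm_gt0 u0.
  move=> h hu; rewrite /k; case: eqVneq => // uh; exfalso.
  by move: hu; rewrite (_ : h = - u) ?nmN ?ltxx //; apply/eqP; rewrite -addr_eq0 addrC uh.
by apply: cint_eq => t _; rewrite /k (negPf (circle_neq0 _ rho0)).
Qed.

Lemma ccont_deriv_integrand f z (rho : R) : 0 < rho ->
  (forall u, nm u <= rho -> exists d', cderiv f (z + u) d') ->
  ccont 0 T (fun t => (f (z + rho%:C * cis t) - f z) * (rho%:C * cis t)^-1).
Proof.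
move=> rho0 df; apply: ccontM; last exact: ccont_circle_inv.
apply: ccontB; last exact: ccont_cst.
apply: ccont_comp; first exact: ccont_circle.
by move=> t _; apply: df; rewrite nm_circle.
Qed.

Lemma bound_from_cint (x : C) (phi : R -> C) (M : R) : cint 0 T phi = T%:C * x ->
  ccont 0 T phi -> (forall t, nm (phi t) <= M) -> nm x <= 2 * M.
Proof.
move=> E cphi bphi; have T0 := twopi_gt0.
have := cint_le (ltW T0) cphi (fun t _ => bphi t).
rewrite E nmM nmR gtr0_norm // subr0.
by rewrite [leLHS]mulrC ler_pM2r.
Qed.

Section Disc.
Variables (f D : C -> C) (r M : R).
Hypothesis r0 : 0 < r.
Hypothesis df : forall u, nm u < r -> cderiv f u (D u).
Hypothesis fM : forall u, nm u < r -> nm (f u) <= M.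

Let M0 : 0 <= M.
Proof. by apply: le_trans (nm_ge0 _) (fM (u := 0) _); rewrite nm0. Qed.

Let rho := r / 4.
Let rho0 : 0 < rho. Proof. by rewrite divr_gt0. Qed.

Let dfz z u : nm z < r / 2 -> nm u <= rho -> exists d', cderiv f (z + u) d'.
Proof.
move=> zr ur; exists (D (z + u)); apply: df; apply: le_lt_trans (nmD _ _) _.
by move: zr ur; rewrite /rho; have := r0; lra.
Qed.

(** [deriv_formula] on the circle of radius r / 4 around z, which stays in the disc:
    16 = 2 * 2 * 4, from [bound_from_cint], the difference of two values
    of f, and the radius. *)
Lemma disc_deriv_bound z : nm z < r / 2 -> nm (D z) <= 16 * M / r.
Proof.
move=> zr; have zr' : nm z < r by have := r0; lra.
have -> : 16 * M / r = 2 * (2 * M / rho) by rewrite /rho; field; rewrite gt_eqF.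
apply: bound_from_cint (deriv_formula rho0 (df zr') (fun u => dfz zr)) _ _.
  exact: ccont_deriv_integrand (fun u => dfz zr).
move=> t; rewrite nmM nmV nm_circle // ler_wpM2r ?invr_ge0 ?(ltW rho0) //.
rewrite (le_trans (nmB _ _)) // mulr_natl mulr2n lerD ?fM //.
apply: le_lt_trans (nmD _ _) _; rewrite nm_circle // /rho; have := r0; lra.
Qed.

Lemma disc_lipschitz z w : nm z < r / 2 -> nm w < r / 2 ->
  nm (f w - f z) <= 32 * M / r * nm (w - z).
Proof.
move=> zr wr.
have := @mean_value_bound _ (fun t : R => f (z + t%:C * (w - z)))
  (fun t => D (z + t%:C * (w - z)) * (w - z)) (16 * M / r * nm (w - z)).
have -> : z + 1%:C * (w - z) = w by rewrite mul1r addrC subrK.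
have -> : z + 0%:C * (w - z) = z by rewrite mul0r addr0.
have -> : 2 * (16 * M / r * nm (w - z)) = 32 * M / r * nm (w - z) by ring.
apply=> t /andP[t0 t1].
have tr : nm (z + t%:C * (w - z)) < r / 2.
  have -> : z + t%:C * (w - z) = (1 - t)%:C * z + t%:C * w by rewrite rmorphB /=; ring.
  apply: le_lt_trans (nmD _ _) _; rewrite !nmM !nmR !ger0_norm ?subr_ge0 //.
  have [m [zm wm mr]] : exists m, [/\ nm z <= m, nm w <= m & m < r / 2].
    by exists (Num.max (nm z) (nm w)); rewrite !le_max !lexx orbT gt_max zr wr.
  apply: le_lt_trans mr; have -> : m = (1 - t) * m + t * m by ring.
  by apply: lerD; rewrite ler_wpM2l ?subr_ge0.
split; last by rewrite nmM ler_wpM2r ?nm_ge0 // disc_deriv_bound.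
by apply: cderiv_line; apply: df; have := r0; lra.
Qed.

(** [deriv_formula] for w and z on circles of the same radius r / 4: the integrands
    differ by differences of f at points at distance |w - z|. *)
Lemma disc_deriv_lipschitz z w : nm z <= r / 8 -> nm w <= r / 8 ->
  nm (D w - D z) <= 512 * M / r ^+ 2 * nm (w - z).
Proof.
move=> zr wr; have r0' := r0.
have [zr2 wr2] : nm z < r / 2 /\ nm w < r / 2 by split; lra.
have [zr1 wr1] : nm z < r /\ nm w < r by split; lra.
have -> : 512 * M / r ^+ 2 * nm (w - z) =
    2 * (64 * M / r * nm (w - z) / rho) by rewrite /rho; field; rewrite gt_eqF.
pose phi u t := (f (u + rho%:C * cis t) - f u) * (rho%:C * cis t)^-1.
have cphi u : nm u < r / 2 -> ccont 0 T (phi u).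
  by move=> ur; exact: ccont_deriv_integrand (fun v => dfz ur).
apply: (@bound_from_cint _ (fun t => phi w t - phi z t)).
- rewrite cintB; [|exact: cphi|exact: cphi].
  by rewrite (deriv_formula rho0 (df wr1) (fun u => dfz wr2))
    (deriv_formula rho0 (df zr1) (fun u => dfz zr2)) mulrBr.
- by apply: ccontB; exact: cphi.
move=> t; rewrite -mulrBl nmM nmV nm_circle // ler_wpM2r ?invr_ge0 ?(ltW rho0) //.
set c := _ * cis t; have cr : nm c = r / 4 by rewrite nm_circle.
have -> : f (w + c) - f w - (f (z + c) - f z) = (f (w + c) - f (z + c)) - (f w - f z).
  by ring.
have L1 := disc_lipschitz zr2 wr2.
have L2 : nm (f (w + c) - f (z + c)) <= 32 * M / r * nm (w - z).
  have -> : w - z = (w + c) - (z + c) by ring.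
  by apply: disc_lipschitz; apply: le_lt_trans (nmD _ _) _; rewrite cr; lra.
by rewrite (le_trans (nmB _ _)) //; lra.
Qed.

(** The mean value inequality for t -> f(t h) - t f'(0) h, whose derivative is
    bounded by the Lipschitz estimate on f'. The constant depends on f only
    through M, which makes the estimate uniform over families of functions. *)
Lemma quadratic_estimate h : nm h <= r / 8 ->
  nm (f h - f 0 - D 0 * h) <= 1024 * M / r ^+ 2 * nm h ^+ 2.
Proof.
move=> hr; have r0' := r0.
have := @mean_value_bound _ (fun t : R => f (0 + t%:C * h) - D 0 * (0 + t%:C * h))
  (fun t => D (0 + t%:C * h) * h - D 0 * h) (512 * M / r ^+ 2 * nm h ^+ 2).
have -> : 0 + 1%:C * h = h by rewrite mul1r add0r.
have -> : 0 + 0%:C * h = 0 by rewrite mul0r add0r.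
rewrite mulr0 subr0.
have -> : f h - D 0 * h - f 0 = f h - f 0 - D 0 * h by ring.
have -> : 2 * (512 * M / r ^+ 2 * nm h ^+ 2) = 1024 * M / r ^+ 2 * nm h ^+ 2 by ring.
apply=> t /andP[t0 t1].
have tr : nm (0 + t%:C * h) <= nm h by rewrite add0r nmM nmR ger0_norm // ler_piMl ?nm_ge0.
split.
  have tr1 : nm (0 + t%:C * h) < r by lra.
  have := @cderiv_line (fun u => f u - D 0 * u) 0 h t (D (0 + t%:C * h) - D 0).
  rewrite mulrBl; apply.
  move=> e e0; have [s s0 sP] := df tr1 e0; exists s => // v /sP.
  congr (nm _ <= _); ring.
rewrite -mulrBl nmM [nm h ^+ 2]expr2 mulrA ler_wpM2r ?nm_ge0 //.
have z8 : nm (0 : C) <= r / 8 by rewrite nm0; lra.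
apply: le_trans (disc_deriv_lipschitz z8 (le_trans tr hr)) _.
have K0 : 0 <= 512 * M / r ^+ 2.
  by apply: divr_ge0; [exact: mulr_ge0 (ler0n _ _) M0|exact: exprn_ge0 (ltW r0)].
by rewrite subr0; exact: ler_wpM2l K0 _ _ tr.
Qed.

End Disc.
End CauchyEstimates.
(** * Holomorphic integrals depending on a parameter *)

Section VectorNorm.
Context {R : realType} {n : nat}.
Local Notation C := R[i].
Local Notation Cn := 'rV[C]_n.
Implicit Types (v : Cn).

Lemma nm_lt_coord v (e : R) : 0 < e ->
  nm v < e <-> forall j, nm (v ord0 j) < e.
Proof.
move=> e0; have eC : 0 < e%:C :> C by rewrite ltcR.
have -> : (nm v < e) = (`|v| < e%:C :> C) by rewrite nmE ltcR.
split=> [vE j|vE].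
  have : ball (0 : Cn) (e%:C) v by rewrite mx_norm_ball /ball_ /= sub0r normrN.
  move=> [_ /(_ ord0 j)].
  by rewrite mxE -ball_normE /= sub0r normrN nmE ltcR.
have : ball (0 : Cn) (e%:C) v.
  split => // i j; rewrite (ord1 i) mxE -ball_normE /= sub0r normrN nmE ltcR.
  exact: vE.
by rewrite mx_norm_ball /ball_ /= sub0r normrN.
Qed.

Lemma nm_coord v j : nm (v ord0 j) <= nm v.
Proof.
apply/ler_addgt0Pl => e e0; apply: ltW.
have E0 : 0 < e + nm v by rewrite ltr_pwDl // nm_ge0.
have [H _] := nm_lt_coord v E0; apply: H.
by rewrite ltrDr.
Qed.

Lemma nm_le_coord v (e : R) : 0 <= e ->
  (forall j, nm (v ord0 j) <= e) -> nm v <= e.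
Proof.
move=> e0 ve; apply/ler_addgt0Pl => d d0; apply: ltW.
have E0 : 0 < d + e by rewrite ltr_pwDl.
have [_ H] := nm_lt_coord v E0; apply: H => j.
by rewrite (le_lt_trans (ve j)) // ltrDr.
Qed.

Definition basis_vec (k : 'I_n) : Cn := delta_mx ord0 k.

Lemma nm_basis k : nm (basis_vec k) <= 1.
Proof.
apply: nm_le_coord => // j; rewrite mxE eqxx /=.
by case: (j == k); rewrite ?nm0 ?nm1.
Qed.

End VectorNorm.

Section ParameterIntegral.
Context {R : realType}.
Local Notation C := R[i].
Context {V : normedModType C}.
Implicit Types (G : V -> C) (p w v : V).

Lemma differentiable_local {W : normedModType C} (G H : V -> W) p : (\forall w \near p, G w = H w) ->
  differentiable G p -> differentiable H p.
Proof.
move=> /nbhs_nmP [d d0 GH] dG.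
have GHp h : nm h < d -> G (p + h) = H (p + h).
  by move=> hd; apply: GH; rewrite addrC addKr.
have E : H \o shift p = cst (H p) + 'd G p +o_ 0 id.
  apply/eqaddoP => e e0; rewrite -nbhs_nearE.
  have eE : e = (Re e)%:C by rewrite RRe_real // gtr0_real.
  have [|s s0 sP] := differentiable_estimate dG (e := Re e); first by rewrite -ltcR -eE.
  apply/nbhs_nmP; exists (Num.min d s); first by rewrite lt_min d0.
  move=> h; rewrite subr0 lt_min => /andP[hd /sP].
  rewrite eE !nmE -rmorphM lecR GHp // -{2}[p]addr0 GHp ?nm0 // addr0.
  congr (nm _ <= _).
  by rewrite -[RHS]/(H (h + p) - (H p + 'd G p h)) opprD addrA [p + h]addrC.
have dE := diff_unique (diff_continuous dG) E.
apply/diff_locallyP; rewrite dE; split; last exact: E.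
exact: diff_continuous dG.
Qed.

Lemma cderiv_affine G p v (u : C) : differentiable G (p + u *: v) ->
  cderiv (fun u => G (p + u *: v)) u ('d G (p + u *: v) v).
Proof.
move=> dG e e0; have V0 : 0 < nm v + 1 by rewrite ltr_wpDl ?nm_ge0.
have [r r0 rP] := differentiable_estimate dG (divr_gt0 e0 V0).
exists (r / (nm v + 1)); first exact: divr_gt0.
move=> s; rewrite ltr_pdivlMr // => sr.
have sv : nm (s *: v) <= nm s * (nm v + 1) by rewrite nmZ ler_wpM2l ?nm_ge0 // lerDl.
have := rP _ (le_lt_trans sv sr).
have -> : p + u *: v + s *: v = p + (u + s) *: v by rewrite scalerDl addrA.
have -> : 'd G (p + u *: v) (s *: v) = 'd G (p + u *: v) v * s.
  by rewrite linearZ; exact: mulrC.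
move=> /le_trans; apply.
apply: le_trans (ler_wpM2l (ltW (divr_gt0 e0 V0)) sv) _.
by rewrite mulrCA mulfVK ?gt_eqF // mulrC.
Qed.

Section Ball.
Variables (G : V -> C) (p : V) (rho M : R).
Hypothesis rho0 : 0 < rho.
Hypothesis dG : forall w, nm (w - p) < rho -> differentiable G w.
Hypothesis GM : forall w, nm (w - p) < rho -> nm (G w) <= M.

Let line v : v != 0 -> 0 < rho / nm v /\
  forall u : C, nm u < rho / nm v -> nm ((p + u *: v) - p) < rho.
Proof.
move=> v0; have nv := nm_gt0 v0; split=> [|u]; first exact: divr_gt0.
by rewrite ltr_pdivlMr // addrC addKr nmZ.
Qed.

(** On the complex line through p in the direction v, the function G becomes a
    function of one variable on the disc of radius rho / |v|; this and the
    next lemma are the one-variable estimates there. *)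
Lemma diff_bound v : nm ('d G p v) <= 16 * M / rho * nm v.
Proof.
have [->|v0] := eqVneq v 0; first by rewrite linear0 !nm0 mulr0.
have [r0 lr] := line v0; have nv := nm_gt0 v0.
have := @disc_deriv_bound _ (fun u => G (p + u *: v))
  (fun u => 'd G (p + u *: v) v) (rho / nm v) M r0.
move=> /(_ (fun u ur => cderiv_affine (dG (lr u ur)))).
move=> /(_ (fun u ur => GM (lr u ur))) /(_ 0).
rewrite nm0 divr_gt0 // scale0r addr0 invf_div mulrA => /(_ isT) /le_trans; apply.
by rewrite [leRHS]mulrAC.
Qed.

Lemma diff_quadratic v : nm v <= rho / 8 ->
  nm (G (p + v) - G p - 'd G p v) <= 1024 * M / rho ^+ 2 * nm v ^+ 2.
Proof.
move=> vr; have [->|v0] := eqVneq v 0.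
  by rewrite linear0 addr0 subrr subr0 !nm0 expr0n /= mulr0.
have [r0 lr] := line v0; have nv := nm_gt0 v0.
have := @quadratic_estimate _ (fun u => G (p + u *: v))
  (fun u => 'd G (p + u *: v) v) (rho / nm v) M r0.
move=> /(_ (fun u ur => cderiv_affine (dG (lr u ur)))).
move=> /(_ (fun u ur => GM (lr u ur))) /(_ 1).
rewrite nm1 scale1r scale0r addr0 mulr1 => /(_ _)/le_trans; apply.
  by rewrite mulrAC ler_pdivlMr // mul1r.
rewrite expr1n mulr1 expr_div_n invf_div mulrA.
by rewrite [leRHS]mulrAC.
Qed.

End Ball.

Lemma ccont_uniform (a b : R) (f : R -> C) :
  (forall e : R, 0 < e -> exists2 g, ccont a b g &
    forall t, a <= t <= b -> nm (f t - g t) <= e) -> ccont a b f.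
Proof.
move=> fg t tab e e0; have e3 : 0 < e / 3 by rewrite divr_gt0.
have [g cg gf] := fg _ e3; have [d d0 dP] := cg t tab _ e3; exists d => // y yab yt.
have -> : f y - f t = (f y - g y) + (g y - g t) - (f t - g t) by ring.
have := gf _ yab; have := gf _ tab; have := dP y yab yt.
have := nmB (f y - g y + (g y - g t)) (f t - g t).
have := nmD (f y - g y) (g y - g t).
lra.
Qed.

(** [diff_quadratic] holds with a constant independent of t. Integrated over t, it
    says that the integral of the differentials is the differential of the
    integral. It also shows that the differentials are uniform limits of
    difference quotients, hence continuous in t and integrable. *)
Lemma differentiable_cint (G : R -> V -> C) (a b rho M : R) p : a <= b -> 0 < rho ->
  (forall t w, a <= t <= b -> nm (w - p) < rho ->
     differentiable (G t) w /\ nm (G t w) <= M) ->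
  (forall w, nm (w - p) < rho -> ccont a b (fun t => G t w)) ->
  differentiable (fun w => cint a b (fun t => G t w)) p.
Proof.
move=> ab rho0 dG cG.
have dG1 t w : a <= t <= b -> nm (w - p) < rho -> differentiable (G t) w.
  by move=> tab wr; case: (dG t w tab wr).
have dG2 t w : a <= t <= b -> nm (w - p) < rho -> nm (G t w) <= M.
  by move=> tab wr; case: (dG t w tab wr).
have pp : nm (p - p) < rho by rewrite subrr nm0.
have M0 : 0 <= M by apply: le_trans (nm_ge0 _) (dG2 a p _ pp); rewrite lexx.
pose K := 1024 * M / rho ^+ 2.
have K0 : 0 <= K by apply: divr_ge0; [exact: mulr_ge0 (ler0n _ _) M0|exact: exprn_ge0 (ltW rho0)].
have quad t v : a <= t <= b -> nm v <= rho / 8 ->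
    nm (G t (p + v) - G t p - 'd (G t) p v) <= K * nm v ^+ 2.
  by move=> tab; apply: diff_quadratic => // w; [exact: dG1|exact: dG2].
have bnd t v : a <= t <= b -> nm ('d (G t) p v) <= 16 * M / rho * nm v.
  by move=> tab; apply: diff_bound => // w; [exact: dG1|exact: dG2].
clearbody K.
have r8 : rho / 8 < rho by rewrite ltr_pdivrMr // ltr_pMr // ltr1n.
have cD v : ccont a b (fun t => 'd (G t) p v).
  have [->|v0] := eqVneq v 0.
    by apply: (@ccont_eq _ _ _ (fun=> 0)) (ccont_cst _) => t _; rewrite linear0.
  have nv := nm_gt0 v0.
  apply: ccont_uniform => e e0.
  (* the difference quotient with step tau is within K tau |v|^2 <= e of the differential *)
  pose tau := Num.min (rho / 8 / nm v) (e / ((K + 1) * nm v ^+ 2)).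
  have K1 : 0 < K + 1 by rewrite ltr_wpDl.
  have N2 : 0 < nm v ^+ 2 by rewrite exprn_gt0.
  have tau0 : 0 < tau by rewrite lt_min !divr_gt0 // mulr_gt0.
  have [tau1 tau2] : tau <= rho / 8 / nm v /\ tau <= e / ((K + 1) * nm v ^+ 2).
    by rewrite /tau !ge_min !lexx orbT.
  have tv : nm (tau%:C *: v) = tau * nm v by rewrite nmZ nmR gtr0_norm.
  have tv8 : nm (tau%:C *: v) <= rho / 8 by rewrite tv -ler_pdivlMr.
  exists (fun t => tau%:C^-1 * (G t (p + tau%:C *: v) - G t p)).
    apply: ccontM; first exact: ccont_cst.
    apply: ccontB; apply: cG => //.
    by rewrite addrC addKr (le_lt_trans tv8).
  move=> t tab; have := quad t _ tab tv8.
  have -> : 'd (G t) p (tau%:C *: v) = tau%:C * 'd (G t) p v by rewrite linearZ.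
  rewrite tv => Q.
  have tC : tau%:C != 0 :> C by apply/eqP => /complexI /eqP; rewrite gt_eqF.
  have -> : 'd (G t) p v - tau%:C^-1 * (G t (p + tau%:C *: v) - G t p) =
    - (tau%:C^-1 * (G t (p + tau%:C *: v) - G t p - tau%:C * 'd (G t) p v)).
    by rewrite [in RHS]mulrBr (mulKf tC) opprB.
  rewrite nmN nmM nmV nmR gtr0_norm // ler_pdivrMl //; apply: le_trans Q _.
  move: tau2; rewrite ler_pdivlMr ?mulr_gt0 // => tau2.
  rewrite exprMn expr2 -mulrA mulrCA ler_wpM2l ?(ltW tau0) //.
  apply: le_trans tau2; rewrite mulrCA ler_wpM2l ?(ltW tau0) //.
  by rewrite ler_wpM2r ?(ltW N2) // lerDl.
pose L v := cint a b (fun t => 'd (G t) p v).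
have [] // := @estimate_differentiable _ _ _ (fun w => cint a b (fun t => G t w)) L p
  (2 * (16 * M / rho) * (b - a)).
- move=> c u v; transitivity (c * L u + L v) => //; rewrite /L.
  rewrite -cintZ // -cintD //; last by apply: ccontM => //; exact: ccont_cst.
  by apply: cint_eq => t _; rewrite linearP.
- move=> v; rewrite /L mulrAC -[X in _ <= X * _]mulrA.
  by apply: cint_le => // t tab; exact: bnd.
move=> e e0; have B0 : 0 < 2 * (K + 1) * (b - a + 1).
  by rewrite !mulr_gt0 // ?ltr_wpDl ?subr_ge0.
exists (Num.min (rho / 8) (e / (2 * (K + 1) * (b - a + 1)))).
  by rewrite lt_min !divr_gt0.
move=> h; rewrite lt_min => /andP[h1 h2].
have hr : nm (p + h - p) < rho by rewrite addrC addKr (lt_trans h1).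
have cGB : ccont a b (fun t => G t (p + h) - G t p) by apply: ccontB; exact: cG.
rewrite /L -(cintB (cG _ hr) (cG _ pp)) -(cintB cGB (cD h)).
apply: le_trans (cint_le (M := K * nm h ^+ 2) ab _ _) _.
- exact: ccontB.
- by move=> t tab; apply: quad => //; exact: ltW.
move: h2; rewrite ltr_pdivlMr // => /ltW h2.
have -> : 2 * (K * nm h ^+ 2) * (b - a) = (nm h * (2 * K * (b - a))) * nm h by ring.
rewrite ler_wpM2r ?nm_ge0 //; apply: le_trans h2.
rewrite ler_wpM2l ?nm_ge0 //; apply: ler_pM; rewrite ?subr_ge0 ?lerDl //.
  by rewrite mulr_ge0.
by rewrite ler_wpM2l // lerDl.
Qed.

End ParameterIntegral.
(** * Division by a coordinate *)

Section PartialDerivative.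
Context {R : realType}.
Local Notation C := R[i].
Local Notation T := (pi *+ 2 : R).
Context {V : normedModType C}.
Implicit Types (g : V -> C) (b p w v : V).

Lemma differentiable_near {W : normedModType C} (f : V -> W) p :
  differentiable f p -> forall e : R, 0 < e ->
  exists2 d : R, 0 < d & forall w, nm (w - p) < d -> nm (f w - f p) < e.
Proof.
move=> /differentiable_continuous cf e e0; apply/nbhs_nmP.
by apply: (cf [set y | nm (y - f p) < e]); apply/nbhs_nmP; exists e.
Qed.

Lemma differentiable_translate (c p : V) : differentiable (fun w => w + c) p.
Proof.
have [] // := @estimate_differentiable _ _ _ (fun w => w + c) (fun w => w) p 1.
- by move=> v; rewrite mul1r.
move=> e e0; exists 1 => // h _.
have -> : p + h + c - (p + c) - h = 0.
  by rewrite (addrAC p h c) [p + c + h]addrC addrK subrr.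
by rewrite nm0 mulr_ge0 ?nm_ge0 // ltW.
Qed.

Lemma ball_bounded g b : (\forall w \near b, differentiable g w) ->
  exists rho M : R, 0 < rho /\ forall w, nm (w - b) < rho ->
    differentiable g w /\ nm (g w) <= M.
Proof.
move=> /nbhs_nmP [r r0 dg]; have dgb : differentiable g b by apply: dg; rewrite subrr nm0.
have [s s0 gs] := differentiable_near dgb ltr01.
exists (Num.min r s), (nm (g b) + 1); split; first by rewrite lt_min r0.
move=> w; rewrite lt_min => /andP[/dg dgw /gs gw]; split=> //.
by rewrite -[g w](subrK (g b)) addrC (le_trans (nmD _ _)) // lerD2l ltW.
Qed.

Lemma ccont_real (a c : R) : ccont a c (fun t => t%:C).
Proof. by move=> x _ e e0; exists e => // y _ yx; rewrite -rmorphB nmR ltW. Qed.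

Lemma ccont_affine g p v (phi : R -> C) (a c : R) : ccont a c phi ->
  (forall t, a <= t <= c -> differentiable g (p + phi t *: v)) ->
  ccont a c (fun t => g (p + phi t *: v)).
Proof.
move=> cphi dg; apply: (@ccont_comp _ (fun u => g (p + u *: v))) => // t tac.
by eexists; apply: cderiv_affine; exact: dg.
Qed.

(** [deriv_formula] on a circle of fixed radius s in the direction v writes the
    directional derivative as an integral over the circle whose integrand is
    holomorphic in w, to which [differentiable_cint] applies. *)
Lemma differentiable_partial g b v : (\forall w \near b, differentiable g w) ->
  \forall p \near b, differentiable (fun w => 'd g w v) p.
Proof.
move=> /ball_bounded [rho [M [rho0 dg]]].
have v1 : 0 < nm v + 1 by rewrite ltr_wpDl ?nm_ge0.
pose s := rho / 4 / (nm v + 1); have s0 : 0 < s by rewrite !divr_gt0.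
have sv (u : C) : nm u <= s -> nm (u *: v) <= rho / 4.
  move=> us; rewrite nmZ; apply: le_trans (ler_pM (nm_ge0 _) (nm_ge0 _) us (lexx _)) _.
  by rewrite /s mulrAC ler_pdivrMr // ler_wpM2l ?lerDl // divr_ge0 // ltW.
apply/nbhs_nmP; exists (rho / 2); first by rewrite divr_gt0.
move=> p pb.
have wb (w : V) (u : C) : nm (w - p) < rho / 4 -> nm u <= s -> nm (w + u *: v - b) < rho.
  move=> wp /sv us; have -> : w + u *: v - b = (w - p) + (p - b) + u *: v.
    by rewrite subrKA addrAC.
  have := nmD (w - p + (p - b)) (u *: v); have := nmD (w - p) (p - b).
  by move: pb wp us; lra.
have wb0 (w : V) : nm (w - p) < rho / 4 -> nm (w - b) < rho.
  by move=> wp; rewrite -[w]addr0 -(scale0r v) wb ?nm0 ?(ltW s0).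
have nc t : nm (s%:C * cis t : C) <= s by rewrite nm_circle.
pose G (t : R) w := (g (w + (s%:C * cis t) *: v) - g w) * (s%:C * cis t)^-1.
have T0 : 0 < T := twopi_gt0.
have T0C : T%:C != 0 :> C by apply/eqP => /complexI /eqP; rewrite gt_eqF.
have line_ex w : nm (w - p) < rho / 4 -> forall u : C, nm u <= s ->
    exists d, cderiv (fun u => g (w + u *: v)) (0 + u) d.
  move=> wp u us; eexists; apply: cderiv_affine; rewrite add0r.
  by have [] := dg _ (wb w u wp us).
have ccG w : nm (w - p) < rho / 4 -> ccont 0 T (fun t => G t w).
  move=> wp; have := ccont_deriv_integrand s0 (line_ex w wp).
  by apply: ccont_eq => t _; rewrite /G add0r scale0r addr0.
have E w : nm (w - p) < rho / 4 -> T%:C^-1 * cint 0 T (fun t => G t w) = 'd g w v.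
  move=> wp; apply: (mulfI T0C); rewrite mulVKf //.
  have dw : cderiv (fun u => g (w + u *: v)) 0 ('d g w v).
    have := @cderiv_affine _ _ g w v 0; rewrite scale0r addr0; apply.
    by have [] := dg _ (wb0 w wp).
  rewrite -(deriv_formula s0 dw (line_ex w wp)).
  by apply: cint_eq => t _; rewrite /G add0r scale0r addr0.
have r4 : 0 < rho / 4 by rewrite divr_gt0.
apply: (@differentiable_local _ _ _ (fun w => T%:C^-1 * cint 0 T (fun t => G t w))).
  by apply/nbhs_nmP; exists (rho / 4).
apply: (@differentiableM _ _ (fun=> T%:C^-1) (fun w => cint 0 T (fun t => G t w)));
  first exact: differentiable_cst.
apply: (@differentiable_cint _ _ G 0 T (rho / 4) (2 * M / s) _ (ltW T0) r4 _ ccG).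
move=> t w _ wp; split.
  apply: (@differentiableM _ _ (fun w => g (w + (s%:C * cis t) *: v) - g w)
    (fun=> (s%:C * cis t)^-1)); last exact: differentiable_cst.
  apply: differentiableB; last by have [] := dg _ (wb0 w wp).
  apply: (@differentiable_comp _ _ _ _ (fun w => w + (s%:C * cis t) *: v)).
    exact: differentiable_translate.
  by have [] := dg _ (wb w _ wp (nc t)).
rewrite nmM nmV nm_circle // ler_wpM2r ?invr_ge0 ?(ltW s0) //.
rewrite (le_trans (nmB _ _)) // mulr_natl mulr2n lerD //.
  by have [] := dg _ (wb w _ wp (nc t)).
by have [] := dg _ (wb0 w wp).
Qed.

End PartialDerivative.

Section Hadamard.
Context {R : realType} {n : nat}.
Local Notation C := R[i].
Local Notation Cn := 'rV[C]_n.

Definition shrink (k : 'I_n) (t : R) (w : Cn) : Cn :=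
  \row_j if j == k then t%:C * w ord0 k else w ord0 j.

Lemma shrinkE k t w :
  shrink k t w = w + (- w ord0 k + t%:C * w ord0 k) *: basis_vec k.
Proof.
apply/rowP => j; rewrite !mxE eqxx /=; case: eqVneq => [->|_].
  by rewrite mulr1 addrA subrr add0r.
by rewrite mulr0 addr0.
Qed.

Lemma nm_shrink k (t : R) (w b : Cn) : 0 <= t <= 1 -> b ord0 k = 0 ->
  nm (shrink k t w - b) <= nm (w - b).
Proof.
move=> /andP[t0 t1] bk; apply: nm_le_coord => [|j]; first exact: nm_ge0.
rewrite !mxE.
have W : nm (w ord0 j - b ord0 j) <= nm (w - b).
  by have := nm_coord (w - b) j; rewrite !mxE.
case: eqVneq => // jk; move: W; rewrite jk bk !subr0 => W.
by rewrite nmM nmR ger0_norm // (le_trans _ W) // ler_piMl ?nm_ge0.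
Qed.

Lemma differentiable_shrink k (t : R) (p : Cn) : 0 <= t <= 1 ->
  differentiable (shrink k t) p.
Proof.
move=> t01.
have lin : linear (shrink k t : Cn -> Cn).
  move=> c u v; apply/rowP => j; rewrite !mxE.
  by case: eqP => // _; rewrite mulrDr mulrCA.
have [] // := @estimate_differentiable _ _ _ (shrink k t) (shrink k t) p 1 lin.
- by move=> v; rewrite mul1r; have := @nm_shrink k t v 0 t01; rewrite !subr0; apply; rewrite mxE.
move=> e e0; exists 1 => // h _.
have -> : shrink k t (p + h) - shrink k t p - shrink k t h = 0.
  apply/rowP => j; rewrite !mxE.
  by case: eqP => _; ring.
by rewrite nm0 mulr_ge0 ?nm_ge0 // ltW.
Qed.

(** By the fundamental theorem of calculus along t -> shrink k t w, the quotient is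
    h(w), the integral over [0, 1] of the k-th partial derivative of g at
    shrink k t w. As b_k = 0, these points are no farther from b than w is. *)
Lemma Hadamard_division (g : Cn -> C) b k : holomorphic_near b g -> b ord0 k = 0 ->
  exists2 h, holomorphic_near b h &
    \forall w \near b, g w = g (shrink k 0 w) + w ord0 k * h w.
Proof.
move=> hg bk; have /nbhs_nmP [r1 r10 dg] := hg.
have /ball_bounded [rho [M [rho0 dd]]] := differentiable_partial (basis_vec k) hg.
pose D w := 'd g w (basis_vec k); rewrite -/D in dd.
pose h w := cint 0 1 (fun t => D (shrink k t w)).
have cD w : nm (w - b) < rho -> ccont 0 1 (fun t => D (shrink k t w)).
  move=> wb; apply: (ccont_eq (f := fun t => D (w + (- w ord0 k + t%:C * w ord0 k) *: basis_vec k))).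
    by move=> t _; rewrite shrinkE.
  apply: ccont_affine.
    apply: ccontD; first exact: ccont_cst.
    by apply: ccontM; [exact: ccont_real|exact: ccont_cst].
  move=> t t01; rewrite -shrinkE; have [] // := dd (shrink k t w).
  by rewrite (le_lt_trans (nm_shrink _ t01 bk)).
exists h.
  apply/nbhs_nmP; exists (rho / 2); first by rewrite divr_gt0.
  move=> p pb; apply: (@differentiable_cint _ _ (fun t w => D (shrink k t w)) 0 1 (rho / 2) M _ ler01 (divr_gt0 rho0 (ltr0n _ 2))).
  - move=> t w t01 wp; have wb : nm (shrink k t w - b) < rho.
      rewrite (le_lt_trans (nm_shrink _ t01 bk)) //.
      have -> : w - b = (w - p) + (p - b) by rewrite subrKA.
      by apply: le_lt_trans (nmD _ _) _; rewrite (splitr rho) ltrD.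
    have [dD DM] := dd _ wb; split; last exact: DM.
    exact: (@differentiable_comp _ _ _ _ (shrink k t) D w
      (differentiable_shrink k w t01) dD).
  - move=> w wp; apply: cD.
    have -> : w - b = (w - p) + (p - b) by rewrite subrKA.
    by apply: le_lt_trans (nmD _ _) _; rewrite (splitr rho) ltrD.
apply/nbhs_nmP; exists (Num.min rho r1); first by rewrite lt_min rho0.
move=> w; rewrite lt_min => /andP[wb wr1].
have F := @cint_FTC _ (fun t => g (shrink k t w)) (fun t => D (shrink k t w) * w ord0 k)
  0 1 ltr01.
rewrite addrC; apply/eqP; rewrite -subr_eq; apply/eqP.
have E1 : shrink k 1 w = w.
  by apply/rowP => j; rewrite mxE mul1r; case: eqP => // ->.
rewrite E1 in F; rewrite -F.
- transitivity (cint 0 1 (fun t => w ord0 k * D (shrink k t w))).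
    by apply: cint_eq => t _; exact: mulrC.
  exact: cintZ (cD w wb).
- by apply: ccontM; [exact: cD|exact: ccont_cst].
have -> : (fun t => g (shrink k t w)) =
    (fun t => g (w + (- w ord0 k + t%:C * w ord0 k) *: basis_vec k)).
  by apply/funext => t; rewrite shrinkE.
move=> t t01; apply: (@cderiv_line _ (fun u => g (w + u *: basis_vec k))).
rewrite /D shrinkE; apply: cderiv_affine; apply: dg; rewrite -shrinkE.
by rewrite (le_lt_trans (nm_shrink _ t01 bk)).
Qed.

End Hadamard.
(** * Functions and relations on a coordinate subspace *)

Section CoordinateSubspace.
Context {R : realType} {n : nat}.
Local Notation C := R[i].
Local Notation Cn := 'rV[C]_n.

Lemma holo_near_coord (k : 'I_n) (b : Cn) : holomorphic_near b (fun w : Cn => w ord0 k).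
Proof. by apply: filterE => w; exact: differentiable_coord. Qed.

Lemma holo_near_comp {m : nat} (phi : Cn -> 'rV[C]_m) (f : 'rV[C]_m -> C) (z : Cn) :
  holomorphic_near z phi -> holomorphic_near (phi z) f ->
  holomorphic_near z (f \o phi).
Proof.
move=> hphi hf.
have cphi : {for z, continuous phi}.
  exact: differentiable_continuous (nbhs_singleton hphi).
have hf' : \forall w \near z, differentiable f (phi w) by exact: cphi _ hf.
by apply: filterS2 hphi hf' => w; exact: differentiable_comp.
Qed.

Lemma shrink_near (k : 'I_n) (b : Cn) (P : Cn -> Prop) : b ord0 k = 0 ->
  (\forall w \near b, P w) -> \forall w \near b, P (shrink k 0 w).
Proof.
move=> bk /nbhs_nmP [d d0 dP]; apply/nbhs_nmP; exists d => // w wb.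
by apply: dP; rewrite (le_lt_trans (nm_shrink _ _ bk)) // lexx ler01.
Qed.

Definition ord_cons {T : Type} q (x : T) (s : 'I_q -> T) (i : 'I_q.+1) : T :=
  if unlift ord0 i is Some j then s j else x.

Lemma ord_cons0 T q (x : T) (s : 'I_q -> T) : ord_cons x s ord0 = x.
Proof. by rewrite /ord_cons unlift_none. Qed.

Lemma ord_consS T q (x : T) (s : 'I_q -> T) j : ord_cons x s (lift ord0 j) = s j.
Proof. by rewrite /ord_cons liftK. Qed.

(** Induction on the number of equations: after division by the first coordinate,
    the restriction of g to its zero set, extended constantly along it, vanishes
    where the other coordinates do. *)
Lemma coord_ideal q (iota : 'I_q -> 'I_n) (g : Cn -> C) (b : Cn) :
  (forall i, b ord0 (iota i) = 0) -> holomorphic_near b g ->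
  (\forall w \near b, (forall i, (w : Cn) ord0 (iota i) = 0) -> g w = 0) ->
  exists2 c : 'I_q -> Cn -> C, (forall i, holomorphic_near b (c i)) &
    \forall w \near b, g w = \sum_i c i w * (w : Cn) ord0 (iota i).
Proof.
elim: q iota g => [|q IHq] iota g b0 hg g0.
  exists (fun _ _ => 0) => [[]//|]; apply: filterS g0 => w g0.
  by rewrite big_ord0 g0 // => -[].
have [h hh gE] := Hadamard_division hg (b0 ord0).
have [|||c hc cE] := IHq (iota \o lift ord0) (g \o shrink (iota ord0) 0).
- by move=> i /=.
- have := shrink_near (b0 ord0) hg; apply: filterS => w dw.
  by apply: differentiable_comp dw; apply: differentiable_shrink; rewrite lexx ler01.
- have := shrink_near (b0 ord0) g0; apply: filterS => w + wi; apply=> i.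
  rewrite mxE; case: eqVneq => [_|]; first by rewrite mul0r.
  by case: (unliftP ord0 i) => [j ->|->]; [move=> _; exact: wi|rewrite eqxx].
exists (ord_cons h c) => [i|].
  by case: (unliftP ord0 i) => [j ->|->]; rewrite ?ord_consS ?ord_cons0.
apply: filterS2 gE cE => w -> /= ->; rewrite big_ord_recl ord_cons0 addrC; congr (_ + _).
  exact: mulrC.
by apply: eq_bigr => i _; rewrite ord_consS.
Qed.

(** The first coefficient vanishes where all other coordinates do: where the first
    coordinate is nonzero the relation says so, elsewhere by continuity. Hence
    it is a combination of the other coordinates; moving its terms to the other
    coefficients leaves a relation among one coordinate less, and what was
    moved is a combination of Koszul relations. *)
Lemma coord_koszul q (iota : 'I_q -> 'I_n) (f : 'I_q -> Cn -> C) (b : Cn) :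
  injective iota -> (forall i, b ord0 (iota i) = 0) ->
  (forall i, holomorphic_near b (f i)) ->
  (\forall w \near b, \sum_i f i w * (w : Cn) ord0 (iota i) = 0) ->
  exists2 c : 'I_q -> 'I_q -> Cn -> C, (forall i j, holomorphic_near b (c i j)) &
    \forall w \near b, forall j,
      f j w = \sum_i (c i j w - c j i w) * (w : Cn) ord0 (iota i).
Proof.
elim: q iota f => [|q IHq] iota f inj b0 hf f0.
  by exists (fun _ _ _ => 0) => [[]//|]; apply: filterE => w [].
set k0 := iota ord0.
have k0N j : (iota (lift ord0 j) == k0) = false.
  by apply/negP => /eqP /inj /eqP; rewrite eq_sym (negPf (neq_lift _ _)).
have f0van : \forall w \near b,
    (forall i, (w : Cn) ord0 ((iota \o lift ord0) i) = 0) -> f ord0 w = 0.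
  have [r r0 rP] : exists2 r : R, 0 < r & forall w : Cn, nm (w - b) < r ->
      differentiable (f ord0) w /\ \sum_i f i w * w ord0 (iota i) = 0.
    by apply/nbhs_nmP; apply: filterS2 (hf ord0) f0.
  apply/nbhs_nmP; exists r => // w wr wi.
  have N0 w' : nm (w' - b) < r -> (forall i, w' ord0 ((iota \o lift ord0) i) = 0) ->
      w' ord0 k0 != 0 -> f ord0 w' = 0.
    move=> w'r w'i w'k; have [_] := rP w' w'r.
    rewrite big_ord_recl big1 ?addr0; last by move=> i _; rewrite [w' _ _]w'i mulr0.
    by move=> /eqP; rewrite mulf_eq0 (negPf w'k) orbF => /eqP.
  have [wk|] := eqVneq (w ord0 k0) 0; last exact: N0.
  have [dw _] := rP w wr.
  apply: nm_eq0; apply/eqP; rewrite eq_le nm_ge0 andbT; apply/ler_addgt0Pl => e e0.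
  rewrite addr0; have [d d0 dP] := differentiable_near dw e0.
  pose t := Num.min (d / 2) ((r - nm (w - b)) / 2).
  have t0 : 0 < t by rewrite lt_min !divr_gt0 // subr_gt0.
  have [t1 t2] : t <= d / 2 /\ t <= (r - nm (w - b)) / 2.
    by rewrite /t !ge_min !lexx orbT.
  clearbody t.
  (* w' is close to w, has a nonzero first coordinate and the same others as w *)
  pose w' := w + t%:C *: basis_vec k0.
  have w'w : nm (w' - w) <= t.
    by rewrite addrC addKr nmZ nmR gtr0_norm // ler_piMr ?nm_basis // ltW.
  have fw' : f ord0 w' = 0.
    apply: N0.
    - have -> : w' - b = (w' - w) + (w - b) by rewrite subrKA.
      by apply: le_lt_trans (nmD _ _) _; lra.
    - by move=> i; rewrite !mxE [w _ _]wi k0N andbF mulr0 addr0.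
    - rewrite !mxE wk !eqxx add0r mulr1.
      by apply/eqP => /complexI /eqP; rewrite gt_eqF.
  have : nm (f ord0 w' - f ord0 w) < e by apply: dP; lra.
  by rewrite fw' sub0r nmN => /ltW.
have [|c hc cE] := coord_ideal _ (hf ord0) f0van; first by move=> i /=.
(* the first coefficient is replaced by its expression, and its terms are spread *)
pose f' j := f (lift ord0 j) \+ (c j \* (fun w : Cn => w ord0 k0)).
have [||||d hd dE] := IHq (iota \o lift ord0) f'.
- by move=> i j /= /inj /lift_inj.
- by move=> i /=.
- by move=> j; apply: holo_nearD => //; apply: holo_nearM => //; exact: holo_near_coord.
- apply: filterS2 cE f0 => w cE; rewrite big_ord_recl cE => E.
  rewrite -[RHS]E mulr_suml addrC -big_split /=; apply: eq_bigr => i _.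
  by rewrite mulrDl mulrAC.
pose D i j := ord_cons (ord_cons (fun=> 0) (fun=> (fun=> 0)) j)
  (fun i' => ord_cons (c i') (d i') j) i.
have D00 : D ord0 ord0 = (fun=> 0) by rewrite /D !ord_cons0.
have D0S j : D ord0 (lift ord0 j) = (fun=> 0) by rewrite /D ord_cons0 ord_consS.
have DS0 i : D (lift ord0 i) ord0 = c i by rewrite /D ord_consS ord_cons0.
have DSS i j : D (lift ord0 i) (lift ord0 j) = d i j by rewrite /D !ord_consS.
exists D => [i j|].
  case: (unliftP ord0 i) => [i' ->|->]; case: (unliftP ord0 j) => [j' ->|->].
  - by rewrite DSS.
  - by rewrite DS0.
  - by rewrite D0S; exact: holo_near0.
  - by rewrite D00; exact: holo_near0.
apply: filterS2 cE dE => w cE dE j; rewrite big_ord_recl.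
case: (unliftP ord0 j) => [j' ->|->].
  rewrite D0S DS0 sub0r; under eq_bigr do rewrite !DSS.
  have /= <- := dE j'; rewrite mulNr addrC.
  by rewrite -[f' j' w]/(f (lift ord0 j') w + c j' w * w ord0 k0) addrK.
rewrite subrr mul0r add0r cE; apply: eq_bigr => i _.
by rewrite DS0 D0S subr0.
Qed.

End CoordinateSubspace.
(** * Local equations of a submanifold *)

Section LocalEquations.
Context {R : realType} {n : nat}.
Local Notation C := R[i].
Local Notation Cn := 'rV[C]_n.
Implicit Types (S : set Cn) (z : Cn).

Definition ideal_basis S z q (phi : 'I_q -> Cn -> C) :=
  forall f, holomorphic_near z f -> (\forall w \near z, S w -> f w = 0) ->
    exists2 c : 'I_q -> Cn -> C, (forall i, holomorphic_near z (c i)) &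
      \forall w \near z, f w = \sum_i c i w * phi i w.

(** Every relation f is the combination of the relations phi_i e_j - phi_j e_i with
    coefficients c_ij, written componentwise. *)
Definition koszul_relations z q (phi : 'I_q -> Cn -> C) :=
  forall f : 'I_q -> Cn -> C, (forall i, holomorphic_near z (f i)) ->
    (\forall w \near z, \sum_i f i w * phi i w = 0) ->
    exists2 c : 'I_q -> 'I_q -> Cn -> C, (forall i j, holomorphic_near z (c i j)) &
      \forall w \near z, forall j, f j w = \sum_i (c i j w - c j i w) * phi i w.

Section Unit.
Variables (z : Cn) (q : nat) (phi : 'I_q -> Cn -> C) (k : 'I_q).
Hypothesis hphi : forall i, holomorphic_near z (phi i).
Hypothesis phik : phi k z != 0.

Lemma near_neq0 : \forall w \near z, phi k w != 0.
Proof.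
have dk : differentiable (phi k) z := nbhs_singleton (hphi k).
have [d d0 dP] := differentiable_near dk (nm_gt0 phik).
apply/nbhs_nmP; exists d => // w /dP H; apply/eqP => w0.
by move: H; rewrite w0 sub0r nmN ltxx.
Qed.

Lemma holo_near_inv : holomorphic_near z (fun w => (phi k w)^-1).
Proof. by apply: filterS2 (hphi k) near_neq0 => w dw w0; exact: differentiableV. Qed.

Lemma unit_ideal_basis S : ideal_basis S z phi.
Proof.
move=> f hf _.
exists (fun i => if i == k then f \* (fun w => (phi k w)^-1) else (fun=> 0)) => [i|].
  by case: eqP => _; [apply: holo_nearM => //; exact: holo_near_inv|exact: holo_near0].
apply: filterS near_neq0 => w w0; rewrite (bigD1 k) //= eqxx big1 ?addr0.
  by rewrite /= mulfVK.
by move=> i /negPf ->; rewrite mul0r.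
Qed.

(** If phi_k is a unit, e_j - (phi_j / phi_k) e_k is a multiple of the Koszul relation
    for k and j, and f is the combination of these with coefficients f_j. *)
Lemma unit_koszul : koszul_relations z phi.
Proof.
move=> f hf f0.
exists (fun i j => if i == k then f j \* (fun w => (phi k w)^-1) else (fun=> 0)) => [i j|].
  by case: eqP => _; [apply: holo_nearM => //; exact: holo_near_inv|exact: holo_near0].
apply: filterS2 near_neq0 f0 => w w0 f0 j.
under eq_bigr do rewrite mulrBl; rewrite sumrB (bigD1 k) //= eqxx big1 ?addr0; last first.
  by move=> i /negPf ->; rewrite mul0r.
rewrite mulfVK //; case: eqVneq => [->|_]; last first.
  by rewrite big1 ?subr0 // => i _; rewrite mul0r.
have E : \sum_i (f i \* (fun w => (phi k w)^-1)) w * phi i w =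
    (\sum_i f i w * phi i w) / phi k w.
  by rewrite mulr_suml; apply: eq_bigr => i _; rewrite /= mulrAC.
by rewrite E f0 mul0r subr0.
Qed.

End Unit.

Section Transport.
Variables (U V : set Cn) (phi psi : Cn -> Cn) (q : nat) (iota : 'I_q -> 'I_n).
Variables (S : set Cn) (z : Cn).
Hypothesis UV : biholomorphic U V phi psi.
Hypothesis inj : injective iota.
Hypothesis Uz : U z.
Hypothesis z0 : forall i, phi z ord0 (iota i) = 0.
Hypothesis SU : forall w, U w -> S w <-> forall i, phi w ord0 (iota i) = 0.

Let psiK : psi (phi z) = z. Proof. by case: UV => _ [/(_ z Uz) []]. Qed.
Let hphi : holomorphic_near z phi. Proof. by case: UV => -[_ _ + _] _; apply. Qed.
Let hpsi : holomorphic_near (phi z) psi.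
Proof. by case: UV => -[_ _ _ +] [/(_ z Uz) [Vz _] _]; apply. Qed.
Let nU : \forall w \near z, U w.
Proof. by case: UV => -[oU _ _ _] _; exact: open_nbhs_nbhs. Qed.
Let nV : \forall w \near phi z, V w.
Proof.
case: UV => -[_ oV _ _] [/(_ z Uz) [Vz _] _].
exact: open_nbhs_nbhs (conj oV Vz).
Qed.

Let push (f : Cn -> C) : holomorphic_near z f -> holomorphic_near (phi z) (f \o psi).
Proof. move=> hf; apply: (holo_near_comp hpsi); rewrite psiK; exact: hf. Qed.

Let near_push (P : Cn -> Prop) :
  (\forall w \near z, P w) -> \forall w \near phi z, P (psi w).
Proof.
have := differentiable_continuous (nbhs_singleton hpsi).
by move=> cpsi HP; apply: cpsi; rewrite psiK.
Qed.

Let near_pull (P : Cn -> Prop) :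
  (\forall w \near phi z, P w) -> \forall w \near z, P (phi w).
Proof.
by have := differentiable_continuous (nbhs_singleton hphi); apply.
Qed.

Let phiK : \forall w \near z, psi (phi w) = w.
Proof. by apply: filterS nU => w Uw; case: UV => _ [/(_ w Uw) []]. Qed.

(** [coord_ideal] for the function f o psi at phi z, composed with phi. *)
Lemma transport_ideal_basis :
  ideal_basis S z (fun i w => phi w ord0 (iota i)).
Proof.
move=> f hf f0; have [|c hc cE] := coord_ideal z0 (push hf).
  apply: filterS2 nV (near_push f0) => w Vw + wi; apply.
  case: UV => _ [_ /(_ w Vw) [Uw wE]]; apply/(SU Uw) => i; rewrite wE; exact: wi.
exists (fun i => c i \o phi) => [i|]; first exact: holo_near_comp hphi (hc i).
by apply: filterS2 phiK (near_pull cE) => w wE /=; rewrite wE.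
Qed.

Lemma transport_koszul :
  koszul_relations z (fun i w => phi w ord0 (iota i)).
Proof.
move=> f hf f0.
have [|c hc cE] := coord_koszul inj z0 (fun i => push (hf i)).
  apply: filterS2 nV (near_push f0) => w Vw.
  by case: UV => _ [_ /(_ w Vw) [Uw wE]]; rewrite wE.
exists (fun i j => c i j \o phi) => [i j|]; first exact: holo_near_comp hphi (hc i j).
by apply: filterS2 phiK (near_pull cE) => w wE E j; have /= <- := E j; rewrite wE.
Qed.

End Transport.

(** At points of U where some equation does not vanish that equation is a unit. This
    covers in particular a point a outside S: the single equation 1 will do on
    the complement of the closure of S. *)
Lemma local_equations (Omega S : set Cn) (a : Cn) : open Omega ->
  complex_submanifold Omega S -> Omega a ->
  exists (U : set Cn) (q : nat) (phi : 'I_q -> Cn -> C),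
    [/\ open U, U a, U `<=` Omega & forall z, U z ->
      [/\ forall i, holomorphic_near z (phi i),
          forall i, \forall w \near z, S w -> phi i w = 0,
          ideal_basis S z phi & koszul_relations z phi]].
Proof.
move=> oO [SO Scl Schart] Oa; have [Sa|NSa] := pselect (S a).
  have [U [V [phi [psi [q [Ua UO UV qn SE]]]]]] := Schart a Sa.
  pose iota := widen_ord qn.
  have inj : injective iota by move=> i j /(congr1 val) /= /val_inj.
  have SU w : U w -> S w <-> forall i : 'I_q, phi w ord0 (iota i) = 0.
    move=> Uw; split=> [Sw i|wi].
      have : (S `&` U) w by [].
      by rewrite SE => -[_ /(_ (iota i))]; apply; exact: (ltn_ord i).
    have : (S `&` U) w.
      rewrite SE; split=> // k kq; rewrite -(wi (Ordinal kq)).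
      by congr (phi w ord0 _); exact: val_inj.
    by case.
  exists U, q, (fun i w => phi w ord0 (iota i)); case: (UV) => -[oU oV hphi hpsi] _.
  split=> // z Uz.
  have hz i : holomorphic_near z (fun w => phi w ord0 (iota i)).
    exact: (holo_near_comp (hphi z Uz) (holo_near_coord _ _)).
  have nU : \forall w \near z, U w by exact: open_nbhs_nbhs.
  have Sz i : \forall w \near z, S w -> phi w ord0 (iota i) = 0.
    by apply: filterS nU => w /SU ->.
  have [z0|/existsNP [k /eqP zk]] := pselect (forall i, phi z ord0 (iota i) = 0).
    split=> //; first exact: (transport_ideal_basis UV).
    exact: (transport_koszul UV).
  split=> //; first exact: (unit_ideal_basis (k := k)).
  exact: (unit_koszul (k := k)).
exists (Omega `&` ~` closure S), 1%N, (fun _ _ => 1); split.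
- by apply: openI => //; apply: closed_openC; exact: closed_closure.
- by split=> // cSa; apply: NSa; apply: Scl.
- by move=> w [].
move=> z [Oz NSz].
have h1 (i : 'I_1) : holomorphic_near z (fun _ : Cn => 1 : C).
  by apply: filterE => w; exact: differentiable_cst.
have n1 : (fun _ : Cn => 1 : C) z != 0 by exact: oner_neq0.
split=> //.
- move=> _; have : \forall w \near z, (~` closure S) w.
    by apply: open_nbhs_nbhs; split=> //; apply: closed_openC; exact: closed_closure.
  by apply: filterS => w NSw Sw; case: NSw; exact: subset_closure.
- exact: (@unit_ideal_basis z 1 (fun _ _ => 1) ord0).
- exact: (@unit_koszul z 1 (fun _ _ => 1) ord0).
Qed.

End LocalEquations.
(** * Local finiteness of the two sheaves *)

Section Sheaf.
Context {R : realType} {n : nat}.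
Local Notation C := R[i].
Local Notation Cn := 'rV[C]_n.
Implicit Types (Omega S U : set Cn) (z : Cn).

Lemma sheaf_stalk_sum Omega q (F : analytic_subsheaf Omega q) z (I : finType)
  (c : I -> stalk z) (u : I -> 'rV[stalk z]_q) : Omega z ->
  (forall i, sheaf_stalk _ _ F z (u i)) -> sheaf_stalk _ _ F z (\sum_i c i *: u i).
Proof.
move=> Oz Fu; apply: big_ind => [|x y|i _].
- exact: sheaf_stalk0.
- exact: sheaf_stalkD.
- exact: sheaf_stalkZ.
Qed.

(** One inclusion suffices, the stalks being submodules; generators are conveniently
    indexed by a sum type. *)
Lemma generates_finType Omega q (F : analytic_subsheaf Omega q) U (I : finType)
  (xi : I -> 'I_q -> Cn -> C) : U `<=` Omega ->
  (forall i, is_section F U (xi i)) ->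
  (forall z, U z -> forall u, sheaf_stalk _ _ F z u ->
     exists c : I -> stalk z, u = \sum_i c i *: germ_vec z (xi i)) ->
  exists m (eta : 'I_m -> 'I_q -> Cn -> C),
    (forall j, is_section F U (eta j)) /\ generates F U eta.
Proof.
move=> UO xiF gen; exists #|I|, (fun j => xi (enum_val j)); split=> [j|z Uz].
  exact: xiF.
apply/seteqP; split=> [u /(gen z Uz) [c ->]|u [c _ <-]].
  exists (fun j => c (enum_val j)) => //.
  by rewrite [RHS](big_enum_val (A := I)).
apply: sheaf_stalk_sum; first exact: UO.
by move=> j; have [_] := xiF (enum_val j); apply.
Qed.

(** Germs of a linear combination of functions: identities near z become identities
    in the stalks at z. *)
Lemma germ_vec_lincomb z (I : finType) q (c : I -> Cn -> C) (xi : I -> 'I_q -> Cn -> C)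
  (f : 'I_q -> Cn -> C) :
  (forall i, holomorphic_near z (c i)) ->
  (forall i l, holomorphic_near z (xi i l)) ->
  (forall l, holomorphic_near z (f l)) ->
  (forall l, \forall w \near z, f l w = \sum_i c i w * xi i l w) ->
  germ_vec z f = \sum_i germ z (c i) *: germ_vec z (xi i).
Proof.
move=> hc hxi hf fE; apply/rowP => l; rewrite summxE mxE.
have [hs gs] := germ_sumM (fun j : 'I_#|I| => hc (enum_val j))
  (fun j => hxi (enum_val j) l).
have -> : germ z (f l) =
    germ z (fun w => \sum_(j < #|I|) c (enum_val j) w * xi (enum_val j) l w).
  apply/germ_eq => //; apply: filterS (fE l) => w ->.
  by rewrite [LHS](big_enum_val (A := I)).
rewrite gs [RHS](big_enum_val (A := I)).
by apply: eq_bigr => j _; rewrite !mxE.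
Qed.

Lemma ideal_section Omega S U (f : Cn -> C) : holomorphic_on U f ->
  (forall z, U z -> \forall w \near z, S w -> f w = 0) ->
  is_section (ideal_sheaf Omega S) U (fun _ : 'I_1 => f).
Proof.
move=> hf f0; split=> // z Uz; exists f; split; [exact: hf|by rewrite mxE|exact: f0].
Qed.

Lemma ideal_generation Omega S U q (phi : 'I_q -> Cn -> C) : U `<=` Omega ->
  (forall i, holomorphic_on U (phi i)) ->
  (forall z, U z -> ideal_basis S z phi) ->
  forall z, U z -> forall u : 'rV[stalk z]_1, sheaf_stalk _ _ (ideal_sheaf Omega S) z u ->
    exists c : 'I_q -> stalk z, u = \sum_i c i *: germ_vec z (fun _ : 'I_1 => phi i).
Proof.
move=> UO hphi gen z Uz u [f [hf fu f0]].
have [c hc cE] := gen z Uz f hf f0; exists (fun i => germ z (c i)).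
rewrite -(germ_vec_lincomb (f := fun _ => f) hc) //.
  by apply/rowP => l; rewrite mxE fu (ord1 l).
by move=> i _; exact: hphi.
Qed.

(** The converse passage, from an identity between germs at z to an identity between
    functions near z. *)
Lemma generates_ideal_basis Omega S N (sigma : 'I_N -> Cn -> C) z : Omega z ->
  (forall j, holomorphic_on Omega (sigma j)) ->
  generates (ideal_sheaf Omega S) Omega (fun j (_ : 'I_1) => sigma j) ->
  ideal_basis S z sigma.
Proof.
move=> Oz hs gen f hf f0.
have : sheaf_stalk _ _ (ideal_sheaf Omega S) z (germ_vec z (fun _ : 'I_1 => f)).
  by exists f; rewrite mxE.
rewrite (gen z Oz) => -[c _ cE].
have /choice [B hB] : forall j, exists f, holomorphic_near z f /\ germ z f = c j.
  by move=> j; have [g hg gE] := germ_surj (c j); exists g.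
exists B => [j|]; first by case: (hB j).
have [hsum gsum] := germ_sumM (fun j => (hB j).1) (fun j => hs j z Oz).
apply/germ_eq => //; rewrite gsum.
move/rowP/(_ ord0): cE; rewrite summxE mxE => <-.
by apply: eq_bigr => j _; rewrite !mxE (hB j).2.
Qed.

Lemma ideal_sheaf_locally_finite Omega S : open Omega ->
  complex_submanifold Omega S -> locally_finite (ideal_sheaf Omega S).
Proof.
move=> oO sS a Oa; have [U [q [phi [oU Ua UO phiP]]]] := local_equations oO sS Oa.
exists U; split=> //; apply: (@generates_finType _ _ _ _ 'I_q (fun i _ => phi i)) => //.
  move=> i; apply: ideal_section => z /phiP [h1 h2 _ _]; [exact: h1|exact: h2].
apply: ideal_generation => //; last by move=> z /phiP [].
by move=> i z /phiP [h _ _ _]; exact: h.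
Qed.

Section ChangeOfGenerators.
Variables (q N : nat) (A : 'I_N -> 'I_q -> Cn -> C) (B : 'I_q -> 'I_N -> Cn -> C).
Variable (phi : 'I_q -> Cn -> C).

(** When sigma = A phi and phi = B sigma, these are the rows of 1 - AB and the Koszul
    relations of phi multiplied by B: relations of sigma in both cases. *)
Definition transferred_relation (t : 'I_N + 'I_q * 'I_q) (l : 'I_N) (w : Cn) : C :=
  match t with
  | inl j => (j == l)%:R - \sum_k A j k w * B k l w
  | inr ik => phi ik.1 w * B ik.2 l w - phi ik.2 w * B ik.1 l w
  end.

Lemma holo_near_sum z (I : finType) (f : I -> Cn -> C) :
  (forall i, holomorphic_near z (f i)) -> holomorphic_near z (fun w => \sum_i f i w).
Proof.
move=> hf; have -> : (fun w => \sum_i f i w) = \sum_i f i.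
  by apply/funext => w; rewrite fct_sumE.
by apply: big_ind => [|x y|i _]; [exact: holo_near0|exact: holo_nearD|exact: hf].
Qed.

Lemma holo_near_transferred z t l : (forall j k, holomorphic_near z (A j k)) ->
  (forall k j, holomorphic_near z (B k j)) -> (forall k, holomorphic_near z (phi k)) ->
  holomorphic_near z (transferred_relation t l).
Proof.
move=> hA hB hphi.
have hsub (f g : Cn -> C) : holomorphic_near z f -> holomorphic_near z g ->
    holomorphic_near z (fun w => f w - g w).
  by apply: filterS2 => w; exact: differentiableB.
case: t => [j|[i k]] /=; apply: hsub.
- by apply: filterE => w; exact: differentiable_cst.
- by apply: holo_near_sum => k; exact: holo_nearM.
- exact: holo_nearM.
- exact: holo_nearM.
Qed.

Lemma transferred_relationP (sigma : 'I_N -> Cn -> C) w t :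
  (forall j, sigma j w = \sum_k A j k w * phi k w) ->
  (forall k, phi k w = \sum_j B k j w * sigma j w) ->
  \sum_l transferred_relation t l w * sigma l w = 0.
Proof.
move=> sE pE; case: t => [j|[i k]] /=.
  under eq_bigr do rewrite mulrBl; rewrite sumrB (bigD1 j) //= eqxx mul1r big1 ?addr0.
    under [X in _ - X]eq_bigr do rewrite mulr_suml.
    rewrite exchange_big /= [X in X - _]sE; apply/eqP; rewrite subr_eq0; apply/eqP.
    apply: eq_bigr => k _; rewrite pE mulr_sumr.
    by apply: eq_bigr => l _; rewrite mulrA.
  by move=> l /negPf lj; rewrite eq_sym lj mul0r.
under eq_bigr do rewrite mulrBl -!mulrA.
by rewrite sumrB -!mulr_sumr -!pE [X in _ - X]mulrC subrr.
Qed.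

(** f = f (1 - AB) + (f A) B, where f A is a combination of Koszul relations of phi. *)
Lemma transferred_relation_decomposition (f : 'I_N -> C) (c : 'I_q -> 'I_q -> C) w l :
  (forall k, \sum_j f j * A j k w = \sum_i (c i k - c k i) * phi i w) ->
  f l = \sum_j f j * transferred_relation (inl j) l w
      + \sum_(ik : 'I_q * 'I_q) c ik.1 ik.2 * transferred_relation (inr ik) l w.
Proof.
move=> cE.
have -> : \sum_j f j * transferred_relation (inl j) l w =
    f l - \sum_k (\sum_j f j * A j k w) * B k l w.
  under eq_bigr do rewrite /= mulrBr; rewrite sumrB (bigD1 l) //= eqxx mulr1 big1 ?addr0.
    congr (_ - _); under eq_bigr do rewrite mulr_sumr.
    rewrite exchange_big; apply: eq_bigr => k _; rewrite mulr_suml.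
    by apply: eq_bigr => j _; rewrite mulrA.
  by move=> j /negPf ->; rewrite mulr0.
rewrite -[LHS]addr0 -addrA; congr (_ + _); apply/eqP; rewrite eq_sym addrC subr_eq0.
apply/eqP; under [RHS]eq_bigr do rewrite cE.
rewrite -(pair_bigA _ (fun i k => c i k * transferred_relation (inr (i, k)) l w)) /=.
under [RHS]eq_bigr do (rewrite mulr_suml; under eq_bigr do rewrite !mulrBl).
under [RHS]eq_bigr do rewrite sumrB.
under eq_bigr do (under eq_bigr do rewrite mulrBr; rewrite sumrB).
rewrite !sumrB; congr (_ - _).
  rewrite exchange_big; apply: eq_bigr => k _; apply: eq_bigr => i _.
  by rewrite mulrA.
by apply: eq_bigr => i _; apply: eq_bigr => k _; rewrite mulrA.
Qed.

End ChangeOfGenerators.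

(** The systems sigma and phi generate the same ideals, so matrices A and B with
    sigma = A phi and phi = B sigma exist at a, hence with the same functions at
    all points near a. There, a relation f of sigma gives the relation f A of phi,
    which is a combination of Koszul relations. *)
Lemma relation_sheaf_locally_finite Omega S N (sigma : 'I_N -> Cn -> C)
  (sigma_S : forall j, is_section (ideal_sheaf Omega S) Omega (fun _ : 'I_1 => sigma j)) :
  open Omega -> complex_submanifold Omega S ->
  generates (ideal_sheaf Omega S) Omega (fun j (_ : 'I_1) => sigma j) ->
  locally_finite (relation_sheaf sigma_S).
Proof.
move=> oO sS gen a Oa.
have hs j : holomorphic_on Omega (sigma j) by have [h _] := sigma_S j; exact: (h ord0).
have [U [q [phi [oU Ua UO phiP]]]] := local_equations oO sS Oa.
have [hphi phi0 phi_gen _] := phiP a Ua.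
have sig0 j : \forall w \near a, S w -> sigma j w = 0.
  have [_ /(_ a Oa) [f [hf fE f0]]] := sigma_S j.
  move: fE; rewrite mxE => /(germ_eq hf (hs j a Oa)) fE.
  by apply: filterS2 fE f0 => w <-.
have /choice [A hA] : forall j, exists A : 'I_q -> Cn -> C,
    (forall k, holomorphic_near a (A k)) /\
    \forall w \near a, sigma j w = \sum_k A k w * phi k w.
  by move=> j; have [A hA AE] := phi_gen _ (hs j a Oa) (sig0 j); exists A.
have /choice [B hB] : forall k, exists B : 'I_N -> Cn -> C,
    (forall j, holomorphic_near a (B j)) /\
    \forall w \near a, phi k w = \sum_j B j w * sigma j w.
  move=> k; have [B hB BE] := generates_ideal_basis Oa hs gen (hphi k) (phi0 k).
  by exists B.
pose P w := [/\ forall j, sigma j w = \sum_k A j k w * phi k w,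
  forall k, phi k w = \sum_j B k j w * sigma j w,
  forall j k, differentiable (A j k) w & forall k j, differentiable (B k j) w].
have nP : \forall w \near a, P w.
  have /filter_forall h1 : forall j, \forall w \near a, sigma j w = \sum_k A j k w * phi k w.
    by move=> j; case: (hA j).
  have /filter_forall h2 : forall k, \forall w \near a, phi k w = \sum_j B k j w * sigma j w.
    by move=> k; case: (hB k).
  have /filter_forall h3 : forall j, \forall w \near a, forall k, differentiable (A j k) w.
    by move=> j; have /filter_forall := (hA j).1.
  have /filter_forall h4 : forall k, \forall w \near a, forall j, differentiable (B k j) w.
    by move=> k; have /filter_forall := (hB k).1.
  by apply: filterS2 (filterI h1 h2) (filterI h3 h4) => w [? ?] [? ?].
(* on the interior the identities in P hold in a neighborhood of each point *)
pose U' := U `&` interior P.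
have U'P z : U' z -> \forall w \near z, P w.
  by move=> [_ iP]; exact: iP.
exists U'; split.
- by apply: openI => //; exact: open_interior.
- by split.
- by move=> w [/UO].
have U'O : U' `<=` Omega by move=> w [/UO].
have hAz z : U' z -> forall j k, holomorphic_near z (A j k).
  by move=> /U'P + j k; apply: filterS => w [].
have hBz z : U' z -> forall k j, holomorphic_near z (B k j).
  by move=> /U'P + k j; apply: filterS => w [].
have hphiz z : U' z -> forall k, holomorphic_near z (phi k).
  by move=> [/phiP [h _ _ _] _].
apply: (@generates_finType _ _ _ _ _ (transferred_relation A B phi)) => //.
  move=> t; split=> [l z U'z|z U'z].
    by apply: holo_near_transferred; [exact: hAz|exact: hBz|exact: hphiz].
  have ht l : holomorphic_near z (transferred_relation A B phi t l).
    by apply: holo_near_transferred; [exact: hAz|exact: hBz|exact: hphiz].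
  apply/(relation_stalk_germ sigma_S (U'O z U'z) ht).
  move=> _; apply: filterS (U'P z U'z) => w [sE pE _ _].
  exact: transferred_relationP.
move=> z U'z u; have [f hf <-] := germ_vec_surj u.
move=> /(relation_stalk_germ sigma_S (U'O z U'z) hf) /(_ ord0) f0.
have [Uz _] := U'z; have [_ _ _ kos] := phiP z Uz.
pose F k w := \sum_j f j w * A j k w.
have hF k : holomorphic_near z (F k).
  by apply: holo_near_sum => j; apply: holo_nearM => //; exact: hAz.
have F0 : \forall w \near z, \sum_k F k w * phi k w = 0.
  apply: filterS2 (U'P z U'z) f0 => w [sE _ _ _] E; rewrite -[RHS]E.
  under [LHS]eq_bigr do rewrite /F mulr_suml.
  rewrite exchange_big; apply: eq_bigr => j _ /=.
  by rewrite sE mulr_sumr; apply: eq_bigr => k _; rewrite mulrA.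
have [c hc cE] := kos F hF F0.
exists (fun t => match t with inl j => germ z (f j) | inr ik => germ z (c ik.1 ik.2) end).
rewrite (germ_vec_lincomb (c := fun t => match t with
   inl j => f j | inr ik => c ik.1 ik.2 end) (xi := transferred_relation A B phi)) //.
- by apply: eq_bigr => -[].
- by case.
- by move=> t l; apply: holo_near_transferred; [exact: hAz|exact: hBz|exact: hphiz].
move=> l; apply: filterS cE => w cE; rewrite big_sumType /=.
exact: (@transferred_relation_decomposition q N A B phi (fun j => f j w)
  (fun i k => c i k w) w l cE).
Qed.

End Sheaf.

Theorem theorem1p2 (R : realType) (n : nat) (Omega S : set 'rV[R[i]]_n)
    (dom_Omega : domain Omega) (sub_S : complex_submanifold Omega S) :
  locally_finite (ideal_sheaf Omega S) /\
  (forall (N : nat) (sigma : 'I_N -> 'rV[R[i]]_n -> R[i])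
      (sigma_S : forall j : 'I_N,
          is_section (ideal_sheaf Omega S) Omega (fun _ : 'I_1 => sigma j)),
    generates (ideal_sheaf Omega S) Omega
      (fun (j : 'I_N) (_ : 'I_1) => sigma j) ->
    locally_finite (relation_sheaf sigma_S)).
Proof.
have [oO _ _] := dom_Omega; split; first exact: ideal_sheaf_locally_finite.
by move=> N sigma sigma_S; exact: relation_sheaf_locally_finite.
Qed.
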